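(* Let $\Sigma$ be a triharmonic Hopf cylinder in a Bianchi-Cartan-Vranceanu space $M^3_{m,\ell}$, where $m,\ell\in\mathbb{R}$. Then $\Sigma$ is CMC, i.e. it has constant mean curvature.
   Context: For $m,\ell\in\mathbb{R}$ the Bianchi-Cartan-Vranceanu (BCV) space is $M^3_{m,\ell}=(\bar M\times\mathbb{R},g)$, where $\bar M=\{(x,y)\in\mathbb{R}^2: 1+m(x^2+y^2)>0\}$ and $$g=\frac{dx^2+dy^2}{[1+m(x^2+y^2)]^2}+\Big[dz+\frac{\ell}{2}\,\frac{y\,dx-x\,dy}{1+m(x^2+y^2)}\Big]^2 .$$ The map $\pi(x,y,z)=(x,y)$ is a Riemannian submersion of $M^3_{m,\ell}$ onto $M^2(4m)=\big(\bar M,h=\frac{dx^2+dy^2}{[1+m(x^2+y^2)]^2}\big)$, a surface of constant curvature $4m$. Given a smooth curve $\gamma:I\to M^2(4m)$ parametrized by arc length ($I$ an interval), the Hopf cylinder over $\gamma$ is the surface $\Sigma=\bigcup_{s\in I}\pi^{-1}(\gamma(s))$, parametrized by $(s,t)\mapsto(x(s),y(s),t)$, where $\gamma(s)=(x(s),y(s))$, and regarded as an immersed surface with the induced metric. Triharmonicity: for an isometric immersion $\varphi:M\to N$ between Riemannian manifolds, let $\tau(\varphi)=\mathrm{trace}\,\nabla d\varphi$ be the tension field, $\nabla^\varphi$ the induced connection on $\varphi^{-1}TN$, and $\overline{\Delta}=-\sum_i\big(\nabla^\varphi_{e_i}\nabla^\varphi_{e_i}-\nabla^\varphi_{\nabla^M_{e_i}e_i}\big)$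 the rough Laplacian on sections of $\varphi^{-1}TN$, with $\{e_i\}$ a local orthonormal frame tangent to $M$. The curvature convention is $R^N(X,Y)Z=\nabla_X\nabla_YZ-\nabla_Y\nabla_XZ-\nabla_{[X,Y]}Z$. The immersion (submanifold) is called triharmonic ($3$-harmonic) if its $3$-tension field vanishes: $$\tau_3(\varphi)=\overline{\Delta}^2\tau(\varphi)-\sum_iR^N\big(\overline{\Delta}\tau(\varphi),d\varphi(e_i)\big)d\varphi(e_i)-\sum_iR^N\big(\nabla^\varphi_{e_i}\tau(\varphi),\tau(\varphi)\big)d\varphi(e_i)=0 .$$ This is the Euler-Lagrange equation of $E_3(\varphi)=\frac12\int_M\sum_j|\nabla^\varphi_{e_j}\tau(\varphi)|^2\,dV$. *)

(* Defs.v *)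
From mathcomp Require Import all_boot all_order all_algebra.
From mathcomp Require Import all_classical all_reals all_analysis.
Import Order.TTheory GRing.Theory Num.Theory.
Import numFieldNormedType.Exports.

Set Implicit Arguments.
Unset Strict Implicit.
Unset Printing Implicit Defensive.

Local Open Scope classical_set_scope.
Local Open Scope ring_scope.

(* Points and tangent vectors of a coordinate domain of dimension n are rows
   'rV[R]_n.  A metric is the field of its Gram matrices in the coordinate
   frame.  Metrics, maps and fields are total functions, and only their values
   near the points of the domain of interest matter. *)

Section RiemannianGeometryInAChart.
Context {R : realType}.

Definition metric n := 'rV[R]_n -> 'M[R]_n.

Definition inner n (G : 'M[R]_n) (v w : 'rV[R]_n) : R :=
  (v *m G *m w^T) 0 0.

Definition coord_field n (i : 'I_n) : 'rV[R]_n -> 'rV[R]_n :=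
  cst (delta_mx 0 i).

Definition partial n (i : 'I_n) (f : 'rV[R]_n -> R) (p : 'rV[R]_n) : R :=
  'D_(delta_mx 0 i) f p.

(* Gamma^k_ij *)
Definition christoffel n (g : metric n) (p : 'rV[R]_n) (k i j : 'I_n) : R :=
  2^-1 * \sum_(h < n) invmx (g p) k h *
    (partial i (fun q => g q j h) p + partial j (fun q => g q i h) p
     - partial h (fun q => g q i j) p).

Definition connection_form n (g : metric n) (p v w : 'rV[R]_n) : 'rV[R]_n :=
  \row_k \sum_(i < n) \sum_(j < n) christoffel g p k i j * v 0 i * w 0 j.

Definition dmap d n (phi : 'rV[R]_d -> 'rV[R]_n) (X : 'rV[R]_d -> 'rV[R]_d)
    (u : 'rV[R]_d) : 'rV[R]_n :=
  'D_(X u) phi u.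

(* The connection nabla^phi induced on phi^{-1}TN by the Levi-Civita
   connection of g. *)
Definition nabla d n (g : metric n) (phi : 'rV[R]_d -> 'rV[R]_n)
    (X : 'rV[R]_d -> 'rV[R]_d) (V : 'rV[R]_d -> 'rV[R]_n)
    (u : 'rV[R]_d) : 'rV[R]_n :=
  'D_(X u) V u + connection_form g (phi u) (dmap phi X u) (V u).

Definition levi_civita n (g : metric n) := nabla g (@id 'rV[R]_n).

(* R(v, w)z at p; the vectors are extended to constant fields, which commute,
   so that the bracket term vanishes. *)
Definition riemann n (g : metric n) (p v w z : 'rV[R]_n) : 'rV[R]_n :=
  levi_civita g (cst v) (levi_civita g (cst w) (cst z)) p
  - levi_civita g (cst w) (levi_civita g (cst v) (cst z)) p.

(* The trace of the bilinear form with values B a b on the coordinate frame;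
   see trace_orthonormal. *)
Definition trace d n (G : 'M[R]_d) (B : 'I_d -> 'I_d -> 'rV[R]_n) : 'rV[R]_n :=
  \sum_(a < d) \sum_(b < d) invmx G a b *: B a b.

Lemma trace_orthonormal d n (G : 'M[R]_d) (B : 'I_d -> 'I_d -> 'rV[R]_n)
    (e : 'I_d -> 'rV[R]_d) :
  (forall i j, inner G (e i) (e j) = (i == j)%:R) ->
  \sum_(i < d) \sum_(a < d) \sum_(b < d) (e i 0 a * e i 0 b) *: B a b
  = trace G B.
Proof.
move=> e_on; pose E : 'M[R]_d := \matrix_(i, a) e i 0 a.
have rowE i : row i E = e i by apply/rowP => a; rewrite !mxE.
have EGE : E *m (G *m E^T) = 1%:M.
  apply/matrixP => i j; rewrite mulmxA !mxE -(e_on i j) /inner -!rowE.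
  by rewrite -row_mul !mxE; apply: eq_bigr => k _; rewrite !mxE.
have [Eu GEu] := mulmx1_unit EGE.
have invG : invmx G = E^T *m E.
  have GEE : G *m (E^T *m E) = 1%:M by rewrite mulmxA (mulmx1C EGE).
  have [Gu _] := mulmx1_unit GEE.
  by rewrite -[RHS]mul1mx -(mulVmx Gu) -mulmxA GEE mulmx1.
rewrite /trace exchange_big /=; apply: eq_bigr => a _.
rewrite exchange_big /=; apply: eq_bigr => b _.
by rewrite -scaler_suml invG !mxE; congr (_ *: _); apply: eq_bigr => i _;
  rewrite !mxE.
Qed.

Section IsometricImmersion.
Variables (d n : nat) (g : metric n) (phi : 'rV[R]_d -> 'rV[R]_n).

Definition induced_metric : metric d := fun u =>
  \matrix_(a, b) inner (g (phi u)) (dmap phi (coord_field a) u)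
                                   (dmap phi (coord_field b) u).

Definition section_hessian (V : 'rV[R]_d -> 'rV[R]_n)
    (X Y : 'rV[R]_d -> 'rV[R]_d) (u : 'rV[R]_d) : 'rV[R]_n :=
  nabla g phi X (nabla g phi Y V) u
  - nabla g phi (levi_civita induced_metric X Y) V u.

Definition rough_laplacian (V : 'rV[R]_d -> 'rV[R]_n) (u : 'rV[R]_d) :
    'rV[R]_n :=
  - trace (induced_metric u)
      (fun a b => section_hessian V (coord_field a) (coord_field b) u).

(* (nabla d phi)(X, Y) *)
Definition second_fundamental_form (X Y : 'rV[R]_d -> 'rV[R]_d)
    (u : 'rV[R]_d) : 'rV[R]_n :=
  nabla g phi X (dmap phi Y) u - dmap phi (levi_civita induced_metric X Y) u.

Definition tension (u : 'rV[R]_d) : 'rV[R]_n :=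
  trace (induced_metric u)
    (fun a b => second_fundamental_form (coord_field a) (coord_field b) u).

Definition tension3 (u : 'rV[R]_d) : 'rV[R]_n :=
  rough_laplacian (rough_laplacian tension) u
  - trace (induced_metric u) (fun a b =>
      riemann g (phi u) (rough_laplacian tension u)
        (dmap phi (coord_field a) u) (dmap phi (coord_field b) u))
  - trace (induced_metric u) (fun a b =>
      riemann g (phi u) (nabla g phi (coord_field a) tension u) (tension u)
        (dmap phi (coord_field b) u)).

Definition triharmonic_on (D : set 'rV[R]_d) : Prop :=
  forall u, D u -> tension3 u = 0.

Definition mean_curvature_vector (u : 'rV[R]_d) : 'rV[R]_n :=
  d%:R^-1 *: tension u.

Definition mean_curvature (u : 'rV[R]_d) : R :=
  Num.sqrt (inner (g (phi u)) (mean_curvature_vector u)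
                              (mean_curvature_vector u)).

Definition cmc_on (D : set 'rV[R]_d) : Prop :=
  exists c : R, forall u, D u -> mean_curvature u = c.

End IsometricImmersion.
End RiemannianGeometryInAChart.

Arguments metric R n : clear implicits.

(* The traces over the coordinate frame used above are the usual sums over a
   local orthonormal frame e: rough_laplacian_frame and tension_frame. *)
Section FrameFormulas.
Context {R : realType}.

Lemma derive_dir d n (f : 'rV[R]_d -> 'rV[R]_n) u v : differentiable f u ->
  'D_v f u = \sum_(a < d) v 0 a *: 'D_(delta_mx 0 a) f u.
Proof.
move=> df; rewrite deriveE// {1}[v]row_sum_delta linear_sum /=.
by apply: eq_bigr => a _; rewrite linearZ /= deriveE.
Qed.

Lemma derive_lincomb d n m (f : 'I_m -> 'rV[R]_d -> R)
    (W : 'I_m -> 'rV[R]_d -> 'rV[R]_n) u v :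
  (forall b, derivable (f b) u v) -> (forall b, derivable (W b) u v) ->
  'D_v (fun w => \sum_(b < m) f b w *: W b w) u =
  \sum_(b < m) ('D_v (f b) u *: W b u + f b u *: 'D_v (W b) u).
Proof.
move=> df dW.
have dWc b i j : derivable (fun x => W b x i j) u v by move/derivable_mxP: (dW b).
pose P b j : 'rV[R]_d -> R := f b * (fun x => W b x 0 j).
have PE j : (fun x => (\sum_(b < m) f b x *: W b x) 0 j) = \sum_(b < m) P b j.
  apply/funext => x; rewrite summxE fct_sumE.
  by apply: eq_bigr => b _; rewrite mxE.
have dP b j : derivable (P b j) u v by exact: derivableM.
rewrite derive_mx; last first.
  by apply/derivable_mxP => i j; rewrite ord1 PE; exact: derivable_sum.
apply/rowP => j; rewrite mxE PE derive_sum; last by move=> b; exact: dP.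
rewrite summxE.
apply: eq_bigr => b _.
rewrite deriveM; [|exact: df|exact: dWc].
rewrite !mxE addrC.
rewrite (derive_mx (dW b)) !mxE.
by congr (_ + _); exact: mulrC.
Qed.

Section ConnectionForm.
Variables (n : nat) (g : metric R n) (p : 'rV[R]_n).

Lemma connection_form_suml m (c : 'I_m -> R) (v : 'I_m -> 'rV[R]_n) w :
  connection_form g p (\sum_(a < m) c a *: v a) w =
  \sum_(a < m) c a *: connection_form g p (v a) w.
Proof.
apply/rowP => k; rewrite summxE !mxE.
under [RHS]eq_bigr do rewrite !mxE mulr_sumr.
rewrite [RHS]exchange_big; apply: eq_bigr => i _ /=.
under [RHS]eq_bigr do rewrite mulr_sumr.
rewrite [RHS]exchange_big; apply: eq_bigr => j _ /=.
rewrite summxE mulr_sumr mulr_suml; apply: eq_bigr => a _.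
rewrite !mxE; move: (christoffel _ _ _ _ _) => C.
by rewrite -!mulrA [LHS]mulrCA.
Qed.

Lemma connection_form_sumr m (c : 'I_m -> R) (v : 'I_m -> 'rV[R]_n) w :
  connection_form g p w (\sum_(a < m) c a *: v a) =
  \sum_(a < m) c a *: connection_form g p w (v a).
Proof.
apply/rowP => k; rewrite summxE !mxE.
under [RHS]eq_bigr do rewrite !mxE mulr_sumr.
rewrite [RHS]exchange_big; apply: eq_bigr => i _ /=.
under [RHS]eq_bigr do rewrite mulr_sumr.
rewrite [RHS]exchange_big; apply: eq_bigr => j _ /=.
rewrite summxE mulr_sumr; apply: eq_bigr => a _.
rewrite !mxE; move: (christoffel _ _ _ _ _) => C.
by rewrite [LHS]mulrCA.
Qed.
End ConnectionForm.

Section InducedConnection.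
Variables (d n : nat) (g : metric R n) (phi : 'rV[R]_d -> 'rV[R]_n).

Lemma nabla_dir X V u : differentiable phi u -> differentiable V u ->
  nabla g phi X V u = \sum_(a < d) X u 0 a *: nabla g phi (coord_field a) V u.
Proof.
move=> dphi dV; rewrite /nabla /dmap /coord_field /cst /=.
rewrite (derive_dir _ dV) (derive_dir _ dphi) connection_form_suml -big_split.
by apply: eq_bigr => a _; rewrite scalerDr.
Qed.

Lemma nabla_leibniz m (f : 'I_m -> 'rV[R]_d -> R)
    (W : 'I_m -> 'rV[R]_d -> 'rV[R]_n) V X u :
  (forall b, derivable (f b) u (X u)) -> (forall b, derivable (W b) u (X u)) ->
  (\near u, V u = \sum_(b < m) f b u *: W b u) ->
  nabla g phi X V u =
  \sum_(b < m) ('D_(X u) (f b) u *: W b u + f b u *: nabla g phi X (W b) u).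
Proof.
move=> df dW VE; rewrite /nabla (near_eq_derive _ VE) (nbhs_singleton VE).
rewrite derive_lincomb // connection_form_sumr -big_split.
by apply: eq_bigr => b _ /=; rewrite scalerDr addrA.
Qed.
End InducedConnection.

Section Immersion.
Variables (d n : nat) (g : metric R n) (phi : 'rV[R]_d -> 'rV[R]_n).
Local Notation G := (induced_metric g phi).

Lemma hessian_tensor (T : ('rV[R]_d -> 'rV[R]_d) -> 'rV[R]_d -> 'rV[R]_n) X Y u :
  (forall Z, \near u, T Z u = \sum_(b < d) Z u 0 b *: T (coord_field b) u) ->
  differentiable phi u ->
  (forall b, differentiable (T (coord_field b)) u) ->
  differentiable Y u ->
  nabla g phi X (T Y) u - T (levi_civita G X Y) u =
  \sum_(a < d) \sum_(b < d) (X u 0 a * Y u 0 b) *: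
    (nabla g phi (coord_field a) (T (coord_field b)) u
     - T (levi_civita G (coord_field a) (coord_field b)) u).
Proof.
move=> TE dphi dT dY.
have dYb b v : derivable (fun w => Y w 0 b) u v.
  by have /diff_derivable/derivable_mxP := dY => /(_ v 0 b).
rewrite (nabla_leibniz _ _ _ _ (TE Y)) //; last first.
  by move=> b; exact: diff_derivable.
have LE : levi_civita G X Y u = \sum_(b < d) ('D_(X u) (fun w => Y w 0 b) u *:
    coord_field b u + Y u 0 b *: \sum_(a < d) X u 0 a *:
      levi_civita G (coord_field a) (coord_field b) u).
  rewrite /levi_civita (@nabla_leibniz _ _ _ _ _ (fun b w => Y w 0 b)
    (@coord_field R d)) //.
  - by apply: eq_bigr => b _; rewrite [in LHS]nabla_dir.
  - by apply: (@filterE _ _ (nbhs_filter u)) => w; exact: row_sum_delta.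
have Tu Z : T Z u = \sum_(b < d) Z u 0 b *: T (coord_field b) u.
  exact: (nbhs_singleton (TE Z)).
have -> : T (levi_civita G X Y) u = \sum_(b < d) ('D_(X u) (fun w => Y w 0 b) u *:
    T (coord_field b) u + Y u 0 b *: \sum_(a < d) X u 0 a *:
      T (levi_civita G (coord_field a) (coord_field b)) u).
  rewrite Tu LE.
  under eq_bigr do rewrite summxE scaler_suml.
  rewrite exchange_big; apply: eq_bigr => b _ /=.
  under eq_bigr do rewrite /coord_field /cst !mxE scalerDl -scalerA.
  rewrite big_split /=; congr (_ + _).
    rewrite (bigD1 b) //= big1 ?addr0; last first.
      by move=> i ib; rewrite (negbTE ib) mulr0 scale0r.
    by rewrite eqxx mulr1.
  rewrite -scaler_sumr; congr (_ *: _).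
  transitivity (\sum_(c < d) \sum_(a < d) (X u 0 a *
      levi_civita G (coord_field a) (coord_field b) u 0 c) *: T (coord_field c) u).
    apply: eq_bigr => c _; rewrite -scaler_suml; congr (_ *: _).
    by rewrite summxE; apply: eq_bigr => a _; rewrite mxE.
  rewrite exchange_big; apply: eq_bigr => a _ /=.
  rewrite Tu scaler_sumr; apply: eq_bigr => c _.
  by rewrite scalerA.
rewrite exchange_big -sumrB; apply: eq_bigr => b _ /=.
rewrite opprD addrACA subrr add0r -scalerBr nabla_dir // -sumrB scaler_sumr.
by apply: eq_bigr => a _; rewrite -scalerBr scalerA mulrC.
Qed.

Lemma section_hessian_tensor V X Y u :
  (\near u, differentiable phi u) -> (\near u, differentiable V u) ->
  (forall b, differentiable (nabla g phi (coord_field b) V) u) ->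
  differentiable Y u ->
  section_hessian g phi V X Y u =
  \sum_(a < d) \sum_(b < d) (X u 0 a * Y u 0 b) *:
    section_hessian g phi V (coord_field a) (coord_field b) u.
Proof.
move=> dphi dV dN dY.
apply: (hessian_tensor (T := fun Z => nabla g phi Z V)) => //.
- move=> Z; apply: (@filterS2 _ _ (nbhs_filter u)) dphi dV => w.
  exact: nabla_dir.
- exact: nbhs_singleton dphi.
Qed.

Lemma second_fundamental_form_tensor X Y u :
  (\near u, differentiable phi u) ->
  (forall b, differentiable (dmap phi (coord_field b)) u) ->
  differentiable Y u ->
  second_fundamental_form g phi X Y u =
  \sum_(a < d) \sum_(b < d) (X u 0 a * Y u 0 b) *:
    second_fundamental_form g phi (coord_field a) (coord_field b) u.
Proof.
move=> dphi ddphi dY; apply: (hessian_tensor (T := dmap phi)) => //.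
- move=> Z; apply: (@filterS _ _ (nbhs_filter u)) dphi => w.
  exact: derive_dir.
- exact: nbhs_singleton dphi.
Qed.

Lemma rough_laplacian_frame V (e : 'I_d -> 'rV[R]_d -> 'rV[R]_d) u :
  (forall i j, inner (G u) (e i u) (e j u) = (i == j)%:R) ->
  (forall i, differentiable (e i) u) ->
  (\near u, differentiable phi u) -> (\near u, differentiable V u) ->
  (forall b, differentiable (nabla g phi (coord_field b) V) u) ->
  rough_laplacian g phi V u =
  - \sum_(i < d) (nabla g phi (e i) (nabla g phi (e i) V) u
                  - nabla g phi (levi_civita G (e i) (e i)) V u).
Proof.
move=> e_on de dphi dV dN; rewrite /rough_laplacian -(trace_orthonormal _ e_on).
by congr (- _); apply: eq_bigr => i _; rewrite -section_hessian_tensor.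
Qed.

Lemma tension_frame (e : 'I_d -> 'rV[R]_d -> 'rV[R]_d) u :
  (forall i j, inner (G u) (e i u) (e j u) = (i == j)%:R) ->
  (forall i, differentiable (e i) u) ->
  (\near u, differentiable phi u) ->
  (forall b, differentiable (dmap phi (coord_field b)) u) ->
  tension g phi u =
  \sum_(i < d) (nabla g phi (e i) (dmap phi (e i)) u
                - dmap phi (levi_civita G (e i) (e i)) u).
Proof.
move=> e_on de dphi ddphi; rewrite /tension -(trace_orthonormal _ e_on).
by apply: eq_bigr => i _; rewrite -second_fundamental_form_tensor.
Qed.
End Immersion.
End FrameFormulas.

Section BianchiCartanVranceanu.
Context {R : realType}.
Variables m l : R.

(* 1 + m (x^2 + y^2), for a point (x, y) or (x, y, z) *)
Definition bcv_factor n (p : 'rV[R]_n.+2) : R :=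
  1 + m * (p 0 0 ^+ 2 + p 0 1 ^+ 2).

Definition bcv_base : set 'rV[R]_2 := [set q | 0 < bcv_factor q].

(* h *)
Definition base_metric : metric R 2 := fun q => ((bcv_factor q ^+ 2)^-1)%:M.

(* dz + (l / 2) (y dx - x dy) / (1 + m (x^2 + y^2)) *)
Definition bcv_form (p : 'rV[R]_3) : 'rV[R]_3 :=
  \row_i [:: l / 2 * (p 0 1 / bcv_factor p);
             - (l / 2 * (p 0 0 / bcv_factor p)); 1]`_i.

Definition bcv_metric : metric R 3 := fun p =>
  diag_mx (\row_i [:: (bcv_factor p ^+ 2)^-1; (bcv_factor p ^+ 2)^-1; 0]`_i)
  + (bcv_form p)^T *m bcv_form p.

End BianchiCartanVranceanu.

Section HopfCylinder.
Context {R : realType}.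

(* At an endpoint of a non-open interval this amounts to gamma having a smooth
   extension across that endpoint. *)
Definition smooth_at (gamma : R -> 'rV[R]_2) (s : R) : Prop :=
  forall k : nat, \forall r \near s, derivable (derive1n k gamma) r 1.

(* (s, t) |-> (x(s), y(s), t) *)
Definition hopf_cylinder (gamma : R -> 'rV[R]_2) (u : 'rV[R]_2) : 'rV[R]_3 :=
  \row_i [:: gamma (u 0 0) 0 0; gamma (u 0 0) 0 1; u 0 1]`_i.

(* I x R *)
Definition cylinder_domain (I : interval R) : set 'rV[R]_2 :=
  [set u | u 0 0 \in I].

End HopfCylinder.

(* Main.v *)
Require Import Defs.
From mathcomp Require Import all_boot all_order all_algebra.
From mathcomp Require Import all_classical all_reals all_analysis.
From mathcomp Require Import ring lra.
Import Order.TTheory GRing.Theory Num.Theory.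
Import numFieldNormedType.Exports.

(* Let T and N be the horizontal lifts of the unit tangent and normal of gamma,
   xi = d/dz, k the curvature of gamma and a = l / 2.  Along the cylinder,
   T, xi is a flat orthonormal frame and
     nabla_T  (f T + g N + h xi) =
       (f' - k g) T + (g' + k f - a h) N + (h' + a g) xi,
     nabla_xi (f T + g N + h xi) = a g T - a f N
   for functions f, g, h of s.  So tau = k N, and the T- and xi-components of
   tau_3 = 0 read
     5 k k''' + 10 k' k'' - 10 k^3 k' - 8 a^2 k k' = 0,
     a (4 k''' - 9 k^2 k' - 4 a^2 k') = 0.
   If a <> 0, eliminate k''' and divide by k' where k' <> 0:
   10 k'' = 3 a^2 k - (5/4) k^3.  Differentiating and eliminating k''' again
   gives 105 k^2 + 28 a^2 = 0, a contradiction.  If a = 0, the first equation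
   has the first integrals C = 2 k k'' + k'^2 - k^4 and
   D = k k'^2 - k^5 / 5 - C k, so that k k'^2 and k^2 k'' are polynomials in k;
   k^5 times the N-component is then a polynomial in k of degree 10 with
   leading coefficient 126/25, and k is locally constant. *)

Set Implicit Arguments.
Unset Strict Implicit.
Unset Printing Implicit Defensive.

Local Open Scope classical_set_scope.
Local Open Scope ring_scope.

(** * Directional derivatives of real- and matrix-valued functions *)

Section DerivativeRules.
Context {R : realType} {V : normedModType R}.
Implicit Types (f g : V -> R) (x v : V).

Lemma is_derive_add f g x v df dg :
  is_derive x v f df -> is_derive x v g dg ->
  is_derive x v (fun y => f y + g y) (df + dg).
Proof. exact: is_deriveD. Qed.

Lemma is_derive_opp f x v df :
  is_derive x v f df -> is_derive x v (fun y => - f y) (- df).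
Proof. exact: is_deriveN. Qed.

Lemma is_derive_mul f g x v df dg :
  is_derive x v f df -> is_derive x v g dg ->
  is_derive x v (fun y => f y * g y) (f x * dg + g x * df).
Proof. exact: is_deriveM. Qed.

Lemma is_derive_exp f n x v df :
  is_derive x v f df ->
  is_derive x v (fun y => f y ^+ n) (n%:R * f x ^+ n.-1 * df).
Proof. by move=> h; have := @is_deriveX _ _ f n x v df h; rewrite exprfctE. Qed.

Lemma is_derive_inv f x v df :
  f x != 0 -> is_derive x v f df ->
  is_derive x v (fun y => (f y)^-1) (- (f x ^+ 2)^-1 * df).
Proof.
move=> f0 [df1 <-]; split; first exact: derivableV.
by rewrite deriveV.
Qed.

(** Lets [derive_rules] build the derivative as an existential variable; the comparison with the
    intended value is then left to [ring] or [field]. *)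
Lemma is_derive_val f x v (df df' : R) :
  is_derive x v f df -> df = df' -> is_derive x v f df'.
Proof. by move=> h <-. Qed.

Lemma is_derive_const (c : R) x v : is_derive x v (fun=> c) 0.
Proof. exact: is_derive_cst. Qed.

Lemma is_derive_mx m n (M : V -> 'M[R]_(m, n)) (dM : 'M[R]_(m, n)) x v :
  (forall i j, is_derive x v (fun y => M y i j) (dM i j)) ->
  is_derive x v M dM.
Proof.
move=> h; have dx : derivable M x v.
  by apply/derivable_mxP => i j; case: (h i j).
split=> //; rewrite derive_mx //; apply/matrixP => i j; rewrite mxE.
by case: (h i j).
Qed.

Lemma is_derive_entry m n (M : V -> 'M[R]_(m, n)) (dM : 'M[R]_(m, n)) x v i j :
  is_derive x v M dM -> is_derive x v (fun y => M y i j) (dM i j).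
Proof.
move=> [dx <-]; split; first by move/derivable_mxP: dx.
by rewrite derive_mx // mxE.
Qed.

End DerivativeRules.

Lemma is_derive_coord {R : realType} n (p v : 'rV[R]_n.+1) i :
  is_derive p v (fun q => q 0 i) (v 0 i).
Proof.
exact: (@is_derive_entry _ _ _ _ (fun q : 'rV[R]_n.+1 => q) v p v 0 i).
Qed.

(* [apply] and plain [refine] would search for [is_derive] instances, which may
   not terminate. *)
Ltac derive_rules :=
  lazymatch goal with
  | |- is_derive _ _ (fun=> ?c) _ => notypeclasses refine (is_derive_const _ _ _)
  | |- is_derive _ _ (fun y => @?f y + @?g y) _ =>
      notypeclasses refine (@is_derive_add _ _ f g _ _ _ _ _ _);
        [derive_rules | derive_rules]
  | |- is_derive _ _ (fun y => - @?f y) _ =>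
      notypeclasses refine (@is_derive_opp _ _ f _ _ _ _); derive_rules
  | |- is_derive _ _ (fun y => @?f y * @?g y) _ =>
      notypeclasses refine (@is_derive_mul _ _ f g _ _ _ _ _ _);
        [derive_rules | derive_rules]
  | |- is_derive _ _ (fun y => @?f y ^+ ?n) _ =>
      notypeclasses refine (@is_derive_exp _ _ f n _ _ _ _); derive_rules
  | |- is_derive _ _ (fun y => (@?f y)^-1) _ =>
      notypeclasses refine (@is_derive_inv _ _ f _ _ _ _ _);
        [cbn beta; try first [assumption | by apply: expf_neq0] | derive_rules]
  | |- is_derive _ _ (fun y => fun_of_matrix y _ ?i) _ =>
      notypeclasses refine (is_derive_coord _ _ i)
  | |- _ => eassumption
  end.

Local Notation row3 a b c := (\row_i [:: a; b; c]`_i : 'rV_3).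

(** * The connection of the BCV metric in coordinates *)

Section BcvConnection.
Context {R : realType}.
Variables m l : R.
Local Notation F := (bcv_factor m).

Lemma ord3P (P : 'I_3 -> Prop) : P 0 -> P 1 -> P ord_max -> forall i, P i.
Proof.
move=> P0 P1 P2 [[|[|[|//]]] ii].
- by rewrite (_ : Ordinal ii = 0) //; exact: val_inj.
- by rewrite (_ : Ordinal ii = 1) //; exact: val_inj.
- by rewrite (_ : Ordinal ii = ord_max) //; exact: val_inj.
Qed.

Lemma sum3 (A : nmodType) (f : 'I_3 -> A) :
  \sum_(i < 3) f i = f 0 + (f 1 + f ord_max).
Proof.
rewrite 2!big_ord_recl big_ord1; congr (_ + (_ + _)); congr (f _); exact: val_inj.
Qed.

(* The part of (D_v theta)(w) that survives symmetrization in v and w. *)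
Definition bcv_dtheta_sym (p v w : 'rV[R]_3) : R :=
  - (l / 2) * (F p ^+ 2)^-1 * (2 * m * (p 0 0 * v 0 0 + p 0 1 * v 0 1)) *
    (p 0 1 * w 0 0 - p 0 0 * w 0 1).

Definition bcv_theta (p v : 'rV[R]_3) : R :=
  l / 2 * (F p)^-1 * (p 0 1 * v 0 0 - p 0 0 * v 0 1) + v 0 ord_max.

(* The horizontal components of the connection form: the Christoffel symbols of
   the conformal metric h, and the term in theta(v) J w + theta(w) J v for the
   rotation J.  As d/dz is a unit Killing field, the vertical part is
   1/2 ((D_v theta)(w) + (D_w theta)(v)). *)
Definition bcv_connection1 (p v w : 'rV[R]_3) : R :=
   - ((F p)^-1 * (2 * m)) *
   ((p 0 0 * v 0 0 + p 0 1 * v 0 1) * w 0 0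
    + (p 0 0 * w 0 0 + p 0 1 * w 0 1) * v 0 0
    - (v 0 0 * w 0 0 + v 0 1 * w 0 1) * p 0 0)
   + l / 2 * (bcv_theta p v * w 0 1 + bcv_theta p w * v 0 1).

Definition bcv_connection2 (p v w : 'rV[R]_3) : R :=
   - ((F p)^-1 * (2 * m)) *
   ((p 0 0 * v 0 0 + p 0 1 * v 0 1) * w 0 1
    + (p 0 0 * w 0 0 + p 0 1 * w 0 1) * v 0 1
    - (v 0 0 * w 0 0 + v 0 1 * w 0 1) * p 0 1)
   - l / 2 * (bcv_theta p v * w 0 0 + bcv_theta p w * v 0 0).

Definition bcv_connection3 (p v w : 'rV[R]_3) : R :=
  2^-1 * (bcv_dtheta_sym p v w + bcv_dtheta_sym p w v)
  - l / 2 * (F p)^-1 * (p 0 1 * bcv_connection1 p v w - p 0 0 * bcv_connection2 p v w).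

Definition bcv_connection (p v w : 'rV[R]_3) : 'rV[R]_3 :=
  row3 (bcv_connection1 p v w) (bcv_connection2 p v w) (bcv_connection3 p v w).

(** With c = l / 2, this is the sum of E E^T over the orthonormal frame F d/dx - c y d/dz, F d/dy +
    c x d/dz, d/dz. *)
Definition bcv_metric_inv (p : 'rV[R]_3) : 'M[R]_3 :=
  let c := l / 2 in
  \matrix_(i, j) (row3 (row3 (F p ^+ 2) 0 (- c * p 0 1 * F p))
       (row3 0 (F p ^+ 2) (c * p 0 0 * F p))
       (row3 (- c * p 0 1 * F p) (c * p 0 0 * F p)
         (1 + c ^+ 2 * (p 0 0 ^+ 2 + p 0 1 ^+ 2))) 0 i 0 j).

Lemma bcv_metric_unitmx p : F p != 0 -> bcv_metric m l p \in unitmx.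
Proof.
move=> F0.
have E : bcv_metric m l p *m bcv_metric_inv p = 1%:M.
  apply/matrixP => i j; rewrite mxE sum3.
  by elim/ord3P: i; elim/ord3P: j; rewrite !(mxE, big_ord1) /=; field.
by have [] := mulmx1_unit E.
Qed.

End BcvConnection.

(** * First derivatives of the BCV metric *)

Section BcvMetricDerivative.
Context {R : realType}.
Variables m l : R.
Local Notation F := (bcv_factor m).

Definition bcv_dfactor (p v : 'rV[R]_3) : R :=
  2 * m * (p 0 0 * v 0 0 + p 0 1 * v 0 1).

Lemma is_derive_bcv_factor (p v : 'rV[R]_3) : is_derive p v (fun q => F q) (bcv_dfactor p v).
Proof.
rewrite /bcv_factor; notypeclasses refine (is_derive_val _ _); [derive_rules|].
by rewrite /bcv_dfactor; ring.
Qed.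

(** Leibniz rule for F^-2 (dx^2 + dy^2) + theta^2; [dt] is D_v theta, whose last entry is 0 because
    the dz-coefficient of theta is constant. *)
Definition bcv_dmetric (p v : 'rV[R]_3) : 'M[R]_3 :=
  let t := bcv_form m l p in
  let dt := row3 (l / 2 * (v 0 1 / F p - p 0 1 * bcv_dfactor p v / F p ^+ 2))
     (- (l / 2 * (v 0 0 / F p - p 0 0 * bcv_dfactor p v / F p ^+ 2))) 0 in
  \matrix_(i, j) (row3 (row3 (- 2 * bcv_dfactor p v / F p ^+ 3) 0 0)
                       (row3 0 (- 2 * bcv_dfactor p v / F p ^+ 3) 0) 0 0 i 0 j
    + (dt 0 i * t 0 j + t 0 i * dt 0 j)).

Lemma is_derive_bcv_metric (p v : 'rV[R]_3) : F p != 0 ->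
  is_derive p v (bcv_metric m l) (bcv_dmetric p v).
Proof.
move=> F0; apply: is_derive_mx => i j.
have dF := is_derive_bcv_factor p v.
(* In this form every entry becomes an explicit scalar expression once i and j are concrete, as the
   syntactic matching of [derive_rules] requires. *)
have E : (fun q => bcv_metric m l q i j) = (fun q =>
  row3 (row3 ((F q ^+ 2)^-1) 0 0) (row3 0 ((F q ^+ 2)^-1) 0) 0 0 i 0 j
   + bcv_form m l q 0 i * bcv_form m l q 0 j).
  apply/funext => q; rewrite !mxE big_ord1 !mxE.
  by elim/ord3P: i; elim/ord3P: j; rewrite ?mxE /= ?mulr1n ?mulr0n ?mxE //=.
rewrite {}E mxE.
elim/ord3P: i; elim/ord3P: j.
all: under eq_fun do rewrite !mxE /=.
all: rewrite !mxE /=.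
all: notypeclasses refine (is_derive_val _ _); [derive_rules|].
all: by rewrite /=; field.
Qed.
End BcvMetricDerivative.

(** * The Koszul formula for constant fields *)

Section Koszul.
Context {R : realType}.

(** The Koszul formula determines the covector dual to nabla_v w, and an invertible metric recovers
    nabla_v w from it. A guessed connection can thus be checked without computing the inverse
    metric. *)
Lemma christoffel_unique n (g : metric R n) (p : 'rV[R]_n)
    (dg : 'rV[R]_n -> 'M[R]_n) (B : 'rV[R]_n -> 'rV[R]_n -> 'rV[R]_n) k i j :
  (g p)^T = g p -> g p \in unitmx ->
  (forall v, is_derive p v g (dg v)) ->
  (forall v w h, (B v w *m g p) 0 h = 2^-1 *
    ((w *m dg v) 0 h + (v *m dg w) 0 h - inner (dg (delta_mx 0 h)) v w)) ->
  christoffel g p k i j = B (delta_mx 0 i) (delta_mx 0 j) 0 k.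
Proof.
move=> gT gu gd BE.
have dgE a b c : partial a (fun q => g q b c) p = dg (delta_mx 0 a) b c.
  by have [_ h] := is_derive_entry b c (gd (delta_mx 0 a)); exact: h.
rewrite -[B _ _](mulmxK gu) mxE /christoffel mulr_sumr.
apply: eq_bigr => h _; rewrite BE !dgE -!rowE /inner -rowE trmx_delta -colE.
have -> : invmx (g p) k h = invmx (g p) h k by rewrite -{1}gT -trmx_inv mxE.
by rewrite !mxE; ring.
Qed.
End Koszul.

(** * Verification of the BCV connection *)

Section BcvLeviCivita.
Context {R : realType}.
Variables m l : R.
Local Notation F := (bcv_factor m).
Local Notation g := (bcv_metric m l).

Lemma bcv_connectionP (p v w : 'rV[R]_3) h : F p != 0 ->
  (bcv_connection m l p v w *m g p) 0 h = 2^-1 *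
    ((w *m bcv_dmetric m l p v) 0 h + (v *m bcv_dmetric m l p w) 0 h
     - inner (bcv_dmetric m l p (delta_mx 0 h)) v w).
Proof.
move=> F0.
elim/ord3P: h; rewrite /inner.
all: rewrite !(mxE, sum3, big_ord1) /=.
all: rewrite /bcv_connection3 /bcv_connection1 /bcv_connection2
  /bcv_theta /bcv_dtheta_sym /bcv_dfactor !mxE /= !mulr1n !mulr0n.
all: rewrite /bcv_factor in F0 *.
all: move: (p 0 0) (p 0 1) F0 => x y F0.
all: move: (v 0 0) (v 0 1) (v 0 ord_max) (w 0 0) (w 0 1) (w 0 ord_max)
  => v0 v1 v2 w0 w1 w2.
all: by field.
Qed.

Lemma bcv_metric_tr p : (g p)^T = g p.
Proof. by rewrite /bcv_metric linearD /= tr_diag_mx trmx_mul trmxK. Qed.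

Lemma connection_form_bcv (p v w : 'rV[R]_3) : F p != 0 ->
  connection_form g p v w = bcv_connection m l p v w.
Proof.
move=> F0; apply/rowP => k; rewrite mxE.
transitivity (\sum_(i < 3) \sum_(j < 3)
  bcv_connection m l p (delta_mx 0 i) (delta_mx 0 j) 0 k * v 0 i * w 0 j).
  apply: eq_bigr => i _; apply: eq_bigr => j _; congr (_ * _ * _).
  apply: (@christoffel_unique _ _ _ _ (bcv_dmetric m l p)).
  - exact: bcv_metric_tr.
  - exact: bcv_metric_unitmx.
  - by move=> u; exact: is_derive_bcv_metric.
  - by move=> u u' h; exact: bcv_connectionP.
(* What remains is the bilinearity of [bcv_connection]; once the inverses of F are generalized it is
   a polynomial identity. *)
rewrite !sum3; elim/ord3P: k; rewrite !mxE /=.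
all: rewrite /bcv_connection3 /bcv_connection1 /bcv_connection2
  /bcv_theta /bcv_dtheta_sym !mxE /=.
all: move: (F p)^-1 (F p ^+ 2)^-1 => f f2; ring.
Qed.
End BcvLeviCivita.

(** * The curvature tensor of the BCV space *)

Section BcvCurvature.
Context {R : realType}.
Variables m l : R.
Local Notation F := (bcv_factor m).
Local Notation g := (bcv_metric m l).
Local Notation a := (l / 2).

Lemma levi_civita_cst (p v : 'rV[R]_3) V : F p != 0 ->
  levi_civita g (cst v) V p = 'D_v V p + bcv_connection m l p v (V p).
Proof.
move=> F0; rewrite /levi_civita /nabla /dmap /cst.
by rewrite derive_id connection_form_bcv.
Qed.

Lemma continuous_bcv_factor (p : 'rV[R]_3) : {for p, continuous (fun q : 'rV[R]_3 => F q)}.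
Proof.
have E i : {for p, continuous (fun q : 'rV[R]_3 => q 0 i)} by exact: coord_continuous.
have E2 i : {for p, continuous (fun q : 'rV[R]_3 => q 0 i ^+ 2)}.
  exact: (continuousM (@E i) (@E i)).
apply: continuousD; first exact: cst_continuous.
apply: continuousM; first exact: cst_continuous.
by apply: continuousD; exact: E2.
Qed.

Lemma near_bcv_factor (p : 'rV[R]_3) : F p != 0 -> \near p, F p != 0.
Proof. by move=> F0; apply: (cvgr_neq0 _ (@continuous_bcv_factor p)). Qed.

(** The derivative along v of [bcv_dtheta_sym p w z] as a function of p. *)
Definition bcv_ddtheta_sym (p v w z : 'rV[R]_3) : R :=
  - a * ((F p ^+ 2)^-1 * (2 * m * (v 0 0 * w 0 0 + v 0 1 * w 0 1)) *
    (p 0 1 * z 0 0 - p 0 0 * z 0 1)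
   + (F p ^+ 2)^-1 * bcv_dfactor m p w * (v 0 1 * z 0 0 - v 0 0 * z 0 1)
   - 2 * (F p ^+ 3)^-1 * bcv_dfactor m p v * bcv_dfactor m p w *
    (p 0 1 * z 0 0 - p 0 0 * z 0 1)).

(* D_v theta (w) *)
Definition bcv_dtheta (p v w : 'rV[R]_3) : R :=
  a * ((F p)^-1 * (v 0 1 * w 0 0 - v 0 0 * w 0 1)
       - (F p ^+ 2)^-1 * bcv_dfactor m p v * (p 0 1 * w 0 0 - p 0 0 * w 0 1)).

(* The derivative along v of bcv_connection1 (i = 0) and bcv_connection2
   (i = 1). *)
Definition bcv_dconnection_base (i : 'I_3) (e1 e2 : R) (p v w z : 'rV[R]_3) : R :=
   ((F p ^+ 2)^-1 * bcv_dfactor m p v * (2 * m)) *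
   ((p 0 0 * w 0 0 + p 0 1 * w 0 1) * z 0 i
    + (p 0 0 * z 0 0 + p 0 1 * z 0 1) * w 0 i
    - (w 0 0 * z 0 0 + w 0 1 * z 0 1) * p 0 i)
   - ((F p)^-1 * (2 * m)) *
   ((v 0 0 * w 0 0 + v 0 1 * w 0 1) * z 0 i
    + (v 0 0 * z 0 0 + v 0 1 * z 0 1) * w 0 i
    - (w 0 0 * z 0 0 + w 0 1 * z 0 1) * v 0 i)
   + a * (bcv_dtheta p v w * e1 + bcv_dtheta p v z * e2).

Definition bcv_dconnection (p v w z : 'rV[R]_3) : 'rV[R]_3 :=
  let d1 := bcv_dconnection_base 0 (z 0 1) (w 0 1) p v w z in
  let d2 := bcv_dconnection_base 1 (- z 0 0) (- w 0 0) p v w z in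
  row3 d1 d2
   (2^-1 * (bcv_ddtheta_sym p v w z + bcv_ddtheta_sym p v z w)
    + a * (F p ^+ 2)^-1 * bcv_dfactor m p v *
      (p 0 1 * bcv_connection1 m l p w z - p 0 0 * bcv_connection2 m l p w z)
    - a * (F p)^-1 * (v 0 1 * bcv_connection1 m l p w z + p 0 1 * d1
         - v 0 0 * bcv_connection2 m l p w z - p 0 0 * d2)).

Lemma is_derive_connection1 (p v w z : 'rV[R]_3) : F p != 0 ->
  is_derive p v (fun q => bcv_connection1 m l q w z)
    (bcv_dconnection_base 0 (z 0 1) (w 0 1) p v w z).
Proof.
move=> F0; have dF := is_derive_bcv_factor m p v.
rewrite /bcv_connection1 /bcv_theta.
notypeclasses refine (is_derive_val _ _); [derive_rules|].
by rewrite /bcv_dconnection_base /bcv_dtheta /=; field.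
Qed.

Lemma is_derive_connection2 (p v w z : 'rV[R]_3) : F p != 0 ->
  is_derive p v (fun q => bcv_connection2 m l q w z)
    (bcv_dconnection_base 1 (- z 0 0) (- w 0 0) p v w z).
Proof.
move=> F0; have dF := is_derive_bcv_factor m p v.
rewrite /bcv_connection2 /bcv_theta.
notypeclasses refine (is_derive_val _ _); [derive_rules|].
by rewrite /bcv_dconnection_base /bcv_dtheta /=; field.
Qed.

Lemma is_derive_connection (p v w z : 'rV[R]_3) : F p != 0 ->
  is_derive p v (fun q => bcv_connection m l q w z) (bcv_dconnection p v w z).
Proof.
move=> F0; have dF := is_derive_bcv_factor m p v.
have d1 := is_derive_connection1 v w z F0.
have d2 := is_derive_connection2 v w z F0.
apply: is_derive_mx => i j; rewrite (ord1 i); elim/ord3P: j.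
- by under eq_fun do rewrite mxE /=; rewrite mxE.
- by under eq_fun do rewrite mxE /=; rewrite mxE.
under eq_fun do rewrite mxE /=; rewrite mxE /=.
rewrite /bcv_connection3 /bcv_dtheta_sym.
notypeclasses refine (is_derive_val _ _); [derive_rules|].
by rewrite /bcv_ddtheta_sym /bcv_dfactor /=; field.
Qed.

Lemma riemann_bcvE (p v w z : 'rV[R]_3) : F p != 0 ->
  riemann g p v w z =
  bcv_dconnection p v w z + bcv_connection m l p v (bcv_connection m l p w z)
  - (bcv_dconnection p w v z + bcv_connection m l p w (bcv_connection m l p v z)).
Proof.
move=> F0.
have E (s t : 'rV[R]_3) :
  levi_civita g (cst s) (levi_civita g (cst t) (cst z)) p =
  bcv_dconnection p s t z + bcv_connection m l p s (bcv_connection m l p t z).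
  (* The formula for the inner covariant derivative holds where F does not vanish; this is an open
     condition, so the formula may be differentiated at p. *)
  have N : \near p, levi_civita g (cst t) (cst z) p = bcv_connection m l p t z.
    apply: filterS (near_bcv_factor F0) => q q0.
    by rewrite levi_civita_cst // derive_cst add0r.
  rewrite levi_civita_cst // (nbhs_singleton N) (near_eq_derive _ N).
  by have [_ ->] := is_derive_connection s t z F0.
by rewrite /riemann !E.
Qed.

Definition bcv_inner (p v w : 'rV[R]_3) : R :=
  (F p ^+ 2)^-1 * (v 0 0 * w 0 0 + v 0 1 * w 0 1)
  + bcv_theta m l p v * bcv_theta m l p w.

(** The curvature tensor of the homogeneous space E(kappa, tau) with base curvature kappa = 4 m and
    bundle curvature tau = a; [row3 0 0 1] is the unit Killing field. Horizontal planes have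
    sectional curvature 4 m - 3 a^2, vertical ones a^2. *)
Definition bcv_curv (p v w z : 'rV[R]_3) : 'rV[R]_3 :=
  let th := bcv_theta m l p in let ip := bcv_inner p in
  (4 * m - 3 * a ^+ 2) *: (ip w z *: v - ip v z *: w)
  - (4 * m - 4 * a ^+ 2) *: (th w * th z *: v - th v * th z *: w
     + (th v * ip w z - th w * ip v z) *: row3 0 0 1).

Lemma riemann_bcv (p v w z : 'rV[R]_3) : F p != 0 ->
  riemann g p v w z = bcv_curv p v w z.
Proof.
move=> F0; rewrite riemann_bcvE //.
apply/rowP => k; elim/ord3P: k.
all: rewrite /bcv_curv /bcv_inner !mxE /=.
all: rewrite /bcv_ddtheta_sym /bcv_connection3 /bcv_connection1 /bcv_connection2
  /bcv_dconnection_base /bcv_theta /bcv_dtheta /bcv_dtheta_sym.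
all: rewrite !mxE /=.
all: rewrite /bcv_connection3 /bcv_connection1 /bcv_connection2
  /bcv_theta /bcv_dtheta_sym /bcv_dfactor.
all: rewrite /bcv_factor in F0 *.
all: move: (p 0 0) (p 0 1) F0 => x y F0.
all: move: (v 0 0) (v 0 1) (v 0 ord_max) (w 0 0) (w 0 1) (w 0 ord_max)
  (z 0 0) (z 0 1) (z 0 ord_max) => v0 v1 v2 w0 w1 w2 z0 z1 z2.
all: by field.
Qed.
End BcvCurvature.

(** * Algebra of the frame T, N, d/dz at a point *)

Section Frame.
Context {R : realType}.
Variables m l : R.
Local Notation F := (bcv_factor m).
Local Notation g := (bcv_metric m l).
Local Notation a := (l / 2).

(* f T + g N + h d/dz, where T and N are the horizontal lifts at (x, y) of
   (x1, y1) and (-y1, x1). *)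
Definition frame (x y x1 y1 f g h : R) : 'rV[R]_3 :=
  row3 (f * x1 - g * y1) (f * y1 + g * x1)
    (h - a / (1 + m * (x ^+ 2 + y ^+ 2)) *
         (f * (y * x1 - x * y1) - g * (x * x1 + y * y1))).

Section AtPoint.
Variables (p : 'rV[R]_3) (x y x1 y1 : R).
Hypotheses (px : p 0 0 = x) (py : p 0 1 = y).
Hypothesis F0 : 1 + m * (x ^+ 2 + y ^+ 2) != 0.
Hypothesis unit1 : y1 ^+ 2 = (1 + m * (x ^+ 2 + y ^+ 2)) ^+ 2 - x1 ^+ 2.
Local Notation fr := (frame x y x1 y1).

Lemma theta_frame f g h : bcv_theta m l p (fr f g h) = h.
Proof. by rewrite /bcv_theta !mxE /= /bcv_factor px py; field. Qed.

(** Keeps the squared speed as a factor: differentiating the induced metric at s requires it near s,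
    where the speed may differ from 1 if I is a single point. *)
Lemma inner_frame_speed f g h f' g' h' :
  bcv_inner m l p (fr f g h) (fr f' g' h') =
  (x1 ^+ 2 + y1 ^+ 2) / (1 + m * (x ^+ 2 + y ^+ 2)) ^+ 2 * (f * f' + g * g')
  + h * h'.
Proof.
by rewrite /bcv_inner !theta_frame /bcv_factor !mxE px py /=; field.
Qed.

Lemma inner_frame f g h f' g' h' :
  bcv_inner m l p (fr f g h) (fr f' g' h') = f * f' + g * g' + h * h'.
Proof.
by rewrite inner_frame_speed unit1 [x1 ^+ 2 + _]addrC subrK divff ?expf_neq0 // mul1r.
Qed.

Lemma frameD f g h f' g' h' :
  fr f g h + fr f' g' h' = fr (f + f') (g + g') (h + h').
Proof. by apply/rowP => i; elim/ord3P: i; rewrite !mxE /=; ring. Qed.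

Lemma frameZ c f g h : c *: fr f g h = fr (c * f) (c * g) (c * h).
Proof. by apply/rowP => i; elim/ord3P: i; rewrite !mxE /=; ring. Qed.

Lemma frameN f g h : - fr f g h = fr (- f) (- g) (- h).
Proof. by rewrite -scaleN1r frameZ !mulN1r. Qed.

Lemma frame_xi : row3 0 0 1 = fr 0 0 1.
Proof. by apply/rowP => i; elim/ord3P: i; rewrite !mxE /=; ring. Qed.

(** The first two coordinates are linear in f and g with determinant x1^2 + y1^2 = F^2, which is
    nonzero; with f = g = 0 the third coordinate is h. *)
Lemma frame_eq0 f g h : fr f g h = 0 -> [/\ f = 0, g = 0 & h = 0].
Proof.
move=> /rowP E.
have E0 := E 0; have E1 := E 1; have E2 := E ord_max.
rewrite !mxE /= in E0 E1 E2.
have U0 : x1 ^+ 2 + y1 ^+ 2 != 0 by rewrite unit1 addrC subrK expf_neq0.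
have f0 : f = 0.
  apply: (mulIf U0); rewrite mul0r.
  by transitivity (x1 * (f * x1 - g * y1) + y1 * (f * y1 + g * x1));
    [ring|rewrite E0 E1; ring].
have g0 : g = 0.
  apply: (mulIf U0); rewrite mul0r.
  by transitivity (x1 * (f * y1 + g * x1) - y1 * (f * x1 - g * y1));
    [ring|rewrite E0 E1; ring].
by split=> //; rewrite -{}E2 f0 g0; ring.
Qed.

Lemma curv_frame f g h f' g' h' f2 g2 h2 :
  let ip := f' * f2 + g' * g2 + h' * h2 in
  let iq := f * f2 + g * g2 + h * h2 in
  let A := 4 * m - 3 * a ^+ 2 in let B := 4 * m - 4 * a ^+ 2 in
  bcv_curv m l p (fr f g h) (fr f' g' h') (fr f2 g2 h2) =
  fr (A * (ip * f - iq * f') - B * (h' * h2 * f - h * h2 * f'))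
     (A * (ip * g - iq * g') - B * (h' * h2 * g - h * h2 * g'))
     (A * (ip * h - iq * h') - B * (h' * h2 * h - h * h2 * h'
        + (h * ip - h' * iq))).
Proof.
rewrite /bcv_curv !theta_frame !inner_frame frame_xi.
rewrite !(frameZ, frameN, frameD); congr frame; ring.
Qed.

Lemma inner_bcv v w : inner (g p) v w = bcv_inner m l p v w.
Proof.
rewrite /inner /bcv_metric mulmxDr mulmxDl mxE; congr (_ + _).
  rewrite mul_mx_diag !(mxE, sum3) /= /bcv_factor px py.
  by rewrite [in LHS]mulr0 mul0r addr0; ring.
rewrite mulmxA -mulmxA !mxE big_ord1; congr (_ * _).
all: by rewrite !(mxE, sum3) /= /bcv_theta /bcv_factor px py; ring.
Qed.
End AtPoint.
End Frame.

(** * Differentiation of frame fields along the cylinder *)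

Section AdaptedFrame.
Context {R : realType}.
Variables m l : R.
Local Notation F := (bcv_factor m).
Local Notation g := (bcv_metric m l).
Local Notation a := (l / 2).

(** Chain rule for the projection to s: fields with coefficients in s alone are differentiated by
    ordinary derivatives. *)
Lemma is_derive_first (f : R -> R) (df : R) (u v : 'rV[R]_2) :
  is_derive (u 0 0) 1 f df ->
  is_derive u v (fun w => f (w 0 0)) (v 0 0 * df).
Proof.
move=> [/derivable1_diffP df1 dfE].
have dc : differentiable (fun w : 'rV[R]_2 => w 0 0) u by exact: differentiable_coord.
have dcomp := differentiable_comp dc df1.
split; first exact: diff_derivable.
rewrite (deriveE _ dcomp) diff_comp //= -[X in 'd f _ X]mulr1.
have -> : 'd (fun w : 'rV[R]_2 => w 0 0) u v = v 0 0.
  rewrite -deriveE //.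
  by have [_ ->] := is_derive_coord u v 0.
by rewrite -[_ * 1]/(_ *: 1) linearZ /= -deriveE // dfE.
Qed.

Variables (gamma : R -> 'rV[R]_2) (x1 y1 : R -> R).
Local Notation phi := (hopf_cylinder gamma).
Local Notation x := (fun s => gamma s 0 0).
Local Notation y := (fun s => gamma s 0 1).

Definition frame_along (s : R) (f g h : R) : 'rV[R]_3 :=
  frame m l (x s) (y s) (x1 s) (y1 s) f g h.

Definition has_velocity (s : R) := is_derive s 1 x (x1 s) /\ is_derive s 1 y (y1 s).

(* Unit speed at s and curvature k.  The logarithmic derivative e of the speed
   vanishes if the speed is 1 near s, but not, a priori, if the interval I is a
   single point. *)
Definition has_curvature (s k e : R) :=
  let F := 1 + m * (x s ^+ 2 + y s ^+ 2) in
  [/\ F != 0, y1 s ^+ 2 = F ^+ 2 - x1 s ^+ 2,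
    is_derive s 1 x1 (- k * y1 s + e * x1 s +
      2 * m / F * (x s * (x1 s ^+ 2 - y1 s ^+ 2) + 2 * y s * x1 s * y1 s)) &
    is_derive s 1 y1 (k * x1 s + e * y1 s +
      2 * m / F * (y s * (y1 s ^+ 2 - x1 s ^+ 2) + 2 * x s * x1 s * y1 s))].

(* d phi (d/ds) = T + slope d/dz *)
Definition slope s := a / (1 + m * (x s ^+ 2 + y s ^+ 2)) *
  (y s * x1 s - x s * y1 s).

Implicit Types (u v : 'rV[R]_2).

Lemma hopf_cylinder0 u : phi u 0 0 = x (u 0 0). Proof. by rewrite mxE. Qed.
Lemma hopf_cylinder1 u : phi u 0 1 = y (u 0 0). Proof. by rewrite mxE. Qed.

Lemma dmap_hopf X u : has_velocity (u 0 0) ->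
  dmap phi X u = frame_along (u 0 0) (X u 0 0) 0
    (X u 0 0 * slope (u 0 0) + X u 0 1).
Proof.
move=> [dx dy].
have : is_derive u (X u) phi (frame_along (u 0 0) (X u 0 0) 0
    (X u 0 0 * slope (u 0 0) + X u 0 1)).
  apply: is_derive_mx => i j; rewrite (ord1 i) /frame_along; elim/ord3P: j; rewrite !mxE /=.
  - under eq_fun do rewrite mxE /=.
    rewrite mul0r subr0; exact: (is_derive_first (X u) dx).
  - under eq_fun do rewrite mxE /=.
    rewrite mul0r addr0; exact: (is_derive_first (X u) dy).
  - under eq_fun do rewrite mxE /=.
    notypeclasses refine (is_derive_val _ _); [exact: is_derive_coord|].
    by rewrite /slope; ring.
by case.
Qed.

(** The value is written as the expected covariant derivative along v_0 T + w xi minus the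
    connection form, so that [nabla_frame] follows by adding the connection form back. *)
Lemma is_derive_frame u v (k e f1 g1 h1 : R) (f gg h : R -> R) :
  has_velocity (u 0 0) -> has_curvature (u 0 0) k e ->
  is_derive (u 0 0) 1 f f1 -> is_derive (u 0 0) 1 gg g1 ->
  is_derive (u 0 0) 1 h h1 ->
  let w := v 0 0 * slope (u 0 0) + v 0 1 in
  is_derive u v (fun w => frame_along (w 0 0) (f (w 0 0)) (gg (w 0 0)) (h (w 0 0)))
   (frame_along (u 0 0)
     (v 0 0 * (f1 - k * gg (u 0 0) + e * f (u 0 0)) + w * (a * gg (u 0 0)))
     (v 0 0 * (g1 + k * f (u 0 0) - a * h (u 0 0) + e * gg (u 0 0))
      - w * (a * f (u 0 0)))
     (v 0 0 * (h1 + a * gg (u 0 0)))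
    - bcv_connection m l (phi u) (frame_along (u 0 0) (v 0 0) 0 w)
            (frame_along (u 0 0) (f (u 0 0)) (gg (u 0 0)) (h (u 0 0)))).
Proof.
move=> [dx dy] [F0 un dx1 dy1] df dg dh w.
have cd (z : R -> R) dz : is_derive (u 0 0) 1 z dz ->
   is_derive u v (fun w => z (w 0 0)) (v 0 0 * dz) by exact: is_derive_first.
move: (cd _ _ dx) (cd _ _ dy) (cd _ _ dx1) (cd _ _ dy1) (cd _ _ df) (cd _ _ dg)
  (cd _ _ dh) => {cd} /= ux uy ux1 uy1 uf ug uh.
apply: is_derive_mx => i j; rewrite (ord1 i); elim/ord3P: j.
all: under eq_fun do rewrite mxE /=.
all: notypeclasses refine (is_derive_val _ _); [derive_rules|].
all: rewrite /frame_along /bcv_connection !mxE /=.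
all: rewrite /bcv_connection3 /bcv_connection1 /bcv_connection2
  ?theta_frame ?hopf_cylinder0 ?hopf_cylinder1 // /bcv_dtheta_sym.
all: rewrite /bcv_factor ?hopf_cylinder0 ?hopf_cylinder1 !mxE /=.
all: move: F0 un; rewrite /w /slope.
all: move: (x (u 0 0)) (y (u 0 0)) (x1 (u 0 0)) (y1 (u 0 0)) => x0 y0 x10 y10 F0 un.
(* Unit speed, solved for y1^2, enters as a rewriting rule. *)
all: by field: un.
Qed.
End AdaptedFrame.

Local Notation row2 a b := (\row_i [:: a; b]`_i : 'rV_2).

Lemma ord2P (P : 'I_2 -> Prop) : P 0 -> P 1 -> forall i, P i.
Proof.
move=> P0 P1 [[|[|//]] ii].
- by rewrite (_ : Ordinal ii = 0) //; exact: val_inj.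
- by rewrite (_ : Ordinal ii = 1) //; exact: val_inj.
Qed.

Lemma sum2 (A : nmodType) (f : 'I_2 -> A) : \sum_(i < 2) f i = f 0 + f 1.
Proof.
rewrite big_ord_recl big_ord1; congr (_ + _); congr (f _); exact: val_inj.
Qed.

(** * Induced metric and Levi-Civita connection of the cylinder *)

Section InducedGeometry.
Context {R : realType}.
Variables m l : R.
Local Notation F := (bcv_factor m).
Local Notation g := (bcv_metric m l).
Local Notation a := (l / 2).
Variables (gamma : R -> 'rV[R]_2) (x1 y1 : R -> R).
Local Notation phi := (hopf_cylinder gamma).
Local Notation x := (fun s => gamma s 0 0).
Local Notation y := (fun s => gamma s 0 1).
Local Notation frame_along := (frame_along m l gamma x1 y1).
Local Notation has_velocity := (has_velocity gamma x1 y1).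
Local Notation has_curvature := (has_curvature m gamma x1 y1).
Local Notation slope := (slope m l gamma x1 y1).
Implicit Types (u v : 'rV[R]_2) (X : 'rV[R]_2 -> 'rV[R]_2) (V : 'rV[R]_2 -> 'rV[R]_3).

Lemma near_first (P : R -> Prop) u :
  (\forall r \near u 0 0, P r) -> \forall w \near u, P ((w : 'rV[R]_2) 0 0).
Proof.
have c : {for u, continuous (fun w : 'rV[R]_2 => w 0 0)} by exact: coord_continuous.
by move=> h; exact: (c _ h).
Qed.

Lemma nabla_frame X (V : 'rV[R]_2 -> 'rV[R]_3) u (k e f1 g1 h1 : R) (f gg h : R -> R) :
  let s := u 0 0 in
  has_velocity s -> has_curvature s k e ->
  is_derive s 1 f f1 -> is_derive s 1 gg g1 -> is_derive s 1 h h1 ->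
  (\forall w \near u, V w = frame_along (w 0 0) (f (w 0 0)) (gg (w 0 0)) (h (w 0 0))) ->
  let w := X u 0 0 * slope s + X u 0 1 in
  nabla g phi X V u = frame_along s
     (X u 0 0 * (f1 - k * gg s + e * f s) + w * (a * gg s))
     (X u 0 0 * (g1 + k * f s - a * h s + e * gg s) - w * (a * f s))
     (X u 0 0 * (h1 + a * gg s)).
Proof.
move=> s j0 j1 df dg dh VE w; rewrite /nabla (near_eq_derive _ VE).
have [F0 un _ _] := j1.
have [_ ->] := is_derive_frame l (X u) j0 j1 df dg dh.
rewrite (nbhs_singleton VE) connection_form_bcv; last first.
  by rewrite /bcv_factor hopf_cylinder0 hopf_cylinder1.
by rewrite (dmap_hopf m l _ j0) subrK.
Qed.

(** Existence suffices: the value b1 cancels in every Hessian against the Levi-Civita term. *)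
Lemma is_derive_slope s k e : has_velocity s -> has_curvature s k e ->
  exists b1, is_derive s 1 slope b1.
Proof.
move=> [dx dy] [F0 _ dx1 dy1]; rewrite /slope; eexists; derive_rules.
Qed.

Definition speed2 s := (x1 s ^+ 2 + y1 s ^+ 2) / (1 + m * (x s ^+ 2 + y s ^+ 2)) ^+ 2.

Lemma is_derive_speed2 s k e : has_velocity s -> has_curvature s k e ->
  is_derive s 1 speed2 (2 * e).
Proof.
move=> [dx dy] [F0 un dx1 dy1]; rewrite /speed2.
notypeclasses refine (is_derive_val _ _); [derive_rules|].
by rewrite /=; field: un.
Qed.

Lemma speed2_unit s k e : has_curvature s k e -> speed2 s = 1.
Proof.
by move=> [F0 un _ _]; rewrite /speed2 un [x1 s ^+ 2 + _]addrC subrK divff ?expf_neq0.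
Qed.

(** The inner products of d/ds = T + b xi and d/dt = xi, where E is the squared length of T. *)
Definition gram (E b : R) : 'M[R]_2 :=
  \matrix_(i, j) row2 (row2 (E + b ^+ 2) b) (row2 b 1) 0 i 0 j.

Lemma induced_metric_hopf u : has_velocity (u 0 0) ->
  1 + m * (x (u 0 0) ^+ 2 + y (u 0 0) ^+ 2) != 0 ->
  induced_metric g phi u = gram (speed2 (u 0 0)) (slope (u 0 0)).
Proof.
move=> j0 F0; apply/matrixP => i j; rewrite mxE !(dmap_hopf m l _ j0).
rewrite (inner_bcv m l (hopf_cylinder0 gamma u) (hopf_cylinder1 gamma u)) //.
rewrite (inner_frame_speed _ _ _ (hopf_cylinder0 gamma u)
  (hopf_cylinder1 gamma u) F0) // -/(speed2 _).
by elim/ord2P: i; elim/ord2P: j; rewrite /coord_field /cst !mxE /=; ring.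
Qed.

Definition gram_inv (b : R) : 'M[R]_2 :=
  \matrix_(i, j) row2 (row2 1 (- b)) (row2 (- b) (1 + b ^+ 2)) 0 i 0 j.

Lemma mul_gram_inv b : gram 1 b *m gram_inv b = 1%:M.
Proof.
apply/matrixP => i j; rewrite mxE sum2.
by elim/ord2P: i; elim/ord2P: j; rewrite !mxE /=; ring.
Qed.

Lemma gram_unitmx b : gram 1 b \in unitmx.
Proof. by have [] := mulmx1_unit (mul_gram_inv b). Qed.

(** This is B(T, T) + B(xi, xi) for T = d/ds - b d/dt and xi = d/dt. *)
Lemma trace_gram n b (B : 'I_2 -> 'I_2 -> 'rV[R]_n) :
  trace (gram 1 b) B =
  B 0 0 - b *: (B 0 1 + B 1 0) + (1 + b ^+ 2) *: B 1 1.
Proof.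
have -> : trace (gram 1 b) B =
    \sum_(i < 2) \sum_(j < 2) gram_inv b i j *: B i j.
  rewrite /trace (_ : invmx _ = gram_inv b) //.
  by rewrite -[LHS]mulmx1 -(mul_gram_inv b) mulKmx // gram_unitmx.
by rewrite !sum2 !mxE /= scale1r !scaleNr scalerDr opprD !addrA.
Qed.

Section Geometry.
Variables (u : 'rV[R]_2) (k e b1 : R).
Local Notation s := (u 0 0).
Hypothesis j0 : \forall r \near s, has_velocity r.
Hypothesis j1 : has_curvature s k e.
Hypothesis db : is_derive s 1 slope b1.

(** By continuity, since near an endpoint of I the curve may be evaluated outside I. *)
Lemma near_factor_curve : \forall r \near s, 1 + m * (x r ^+ 2 + y r ^+ 2) != 0.
Proof.
have [dx dy] := nbhs_singleton j0.
have [F0 _ _ _] := j1.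
have d : derivable (fun r => 1 + m * (x r ^+ 2 + y r ^+ 2)) s 1.
  have : exists d, is_derive s 1 (fun r => 1 + m * (x r ^+ 2 + y r ^+ 2)) d.
    by eexists; derive_rules.
  by case=> d [].
by have /derivable1_diffP/differentiable_continuous/cvgr_neq0 := d; exact.
Qed.

Lemma induced_metric_near :
  \forall w \near u, induced_metric g phi w =
    gram (speed2 ((w : 'rV[R]_2) 0 0)) (slope (w 0 0)).
Proof.
apply: filterS2 (near_first j0) (near_first near_factor_curve) => w J0 F0.
exact: induced_metric_hopf.
Qed.

Lemma induced_metricE : induced_metric g phi u = gram 1 (slope s).
Proof. by rewrite (nbhs_singleton induced_metric_near) (speed2_unit j1). Qed.

(** At s, nabla_T T = e T and the other derivatives of T and xi vanish. Hence nabla_(d/ds) d/ds = e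
    T + b1 xi = e d/ds + (b1 - e b) d/dt is the only nonzero one, b being the slope. *)
Lemma levi_civita_induced (c d : 'I_2) :
  levi_civita (induced_metric g phi) (coord_field c) (coord_field d) u =
  ((c == 0) && (d == 0))%:R *: row2 e (b1 - e * slope s).
Proof.
have de := is_derive_speed2 (nbhs_singleton j0) j1.
pose dg (v : 'rV[R]_2) : 'M[R]_2 :=
  v 0 0 *: \matrix_(i, j) row2 (row2 (2 * e + 2 * slope s * b1) b1) (row2 b1 0) 0 i 0 j.
have dG v : is_derive u v (induced_metric g phi) (dg v).
  apply: (@near_eq_is_derive _ _ _
    (fun w : 'rV[R]_2 => gram (speed2 (w 0 0)) (slope (w 0 0)))).
    by apply: filterS induced_metric_near => w h; rewrite h.
  apply: is_derive_mx => i j.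
  have uE := is_derive_first v de.
  have ub := is_derive_first v db.
  elim/ord2P: i; elim/ord2P: j.
  1-4: under eq_fun do rewrite /gram !mxE /=.
  1-4: notypeclasses refine (is_derive_val _ _); [derive_rules|].
  1-4: by rewrite !mxE /=; ring.
pose B (v w : 'rV[R]_2) : 'rV[R]_2 :=
  (v 0 0 * w 0 0) *: row2 e (b1 - e * slope s).
have C k' i j : christoffel (induced_metric g phi) u k' i j =
    B (delta_mx 0 i) (delta_mx 0 j) 0 k'.
  apply: (@christoffel_unique _ _ _ _ dg).
  - by rewrite induced_metricE; apply/matrixP => i' j'; elim/ord2P: i';
      elim/ord2P: j'; rewrite !mxE.
  - by rewrite induced_metricE gram_unitmx.
  - move=> v w h; rewrite induced_metricE /inner.
    by elim/ord2P: h; rewrite !(mxE, sum2) /=; field.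
rewrite /levi_civita /nabla /dmap /coord_field derive_cst add0r derive_id /=.
apply/rowP => i; rewrite mxE.
rewrite (bigD1 c) //= (bigD1 d) //= C !big1 ?addr0; last first.
- by move=> j jd; rewrite !mxE (negbTE jd) andbF mulr0.
- move=> j jc; rewrite big1 // => j' _.
  by rewrite !mxE (negbTE jc) andbF mulr0 mul0r.
by rewrite !mxE !eqxx !mulr1 /= -mulnb natrM [0 == c]eq_sym [0 == d]eq_sym.
Qed.
End Geometry.
End InducedGeometry.

(** * Tension field and rough Laplacian of the cylinder *)

Section Tension.
Context {R : realType}.
Variables m l : R.
Local Notation F := (bcv_factor m).
Local Notation g := (bcv_metric m l).
Local Notation a := (l / 2).
Variables (gamma : R -> 'rV[R]_2) (x1 y1 : R -> R).
Local Notation phi := (hopf_cylinder gamma).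
Local Notation x := (fun s => gamma s 0 0).
Local Notation y := (fun s => gamma s 0 1).
Local Notation frame_along := (frame_along m l gamma x1 y1).
Local Notation has_velocity := (has_velocity gamma x1 y1).
Local Notation has_curvature := (has_curvature m gamma x1 y1).
Local Notation slope := (slope m l gamma x1 y1).
Implicit Types (u v : 'rV[R]_2) (X : 'rV[R]_2 -> 'rV[R]_2) (V : 'rV[R]_2 -> 'rV[R]_3).

Lemma frame_alongD s f g h f' g' h' :
  frame_along s f g h + frame_along s f' g' h' = frame_along s (f + f') (g + g') (h + h').
Proof. exact: frameD. Qed.
Lemma frame_alongN s f g h : - frame_along s f g h = frame_along s (- f) (- g) (- h).
Proof. exact: frameN. Qed.
Lemma frame_alongZ c s f g h : c *: frame_along s f g h = frame_along s (c * f) (c * g) (c * h).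
Proof. exact: frameZ. Qed.
Definition frame_alongE := (frame_alongD, frame_alongN, frame_alongZ).

(** The second fundamental form takes the values k N on (T, T), - a N on (T, xi) and 0 on (xi, xi);
    the tangential e T cancels. *)
Lemma tension_hopf u k e :
  (\forall r \near u 0 0, has_velocity r) -> has_curvature (u 0 0) k e ->
  tension g phi u = frame_along (u 0 0) 0 k 0.
Proof.
move=> j0 j1; have J0 := nbhs_singleton j0.
have [b1 db] := is_derive_slope l J0 j1.
(* The booleans are the coordinates of the two coordinate fields, so one computation covers all four
   entries. *)
have N c d : nabla g phi (coord_field c) (dmap phi (coord_field d)) u =
   let c0 := (c == 0)%:R in let d0 := (d == 0)%:R in
   let w := c0 * slope (u 0 0) + (c == 1)%:R in
   frame_along (u 0 0) (c0 * (e * d0))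
    (c0 * (k * d0 - a * (d0 * slope (u 0 0) + (d == 1)%:R)) - w * (a * d0))
    (c0 * (d0 * b1)).
  have h0 := is_derive_const (d == 0)%:R (u 0 0) 1.
  have h1 := is_derive_const 0 (u 0 0) 1.
  have h2 : is_derive (u 0 0) 1 (fun r => (d == 0)%:R * slope r + (d == 1)%:R)
     ((d == 0)%:R * b1).
    by notypeclasses refine (is_derive_val _ _); [derive_rules|rewrite /=; ring].
  rewrite (nabla_frame _ J0 j1 h0 h1 h2).
    rewrite /coord_field /cst !mxE /= ![_ == c]eq_sym.
    by congr frame_along; ring.
  apply: filterS (near_first j0) => w jw; rewrite (dmap_hopf m l _ jw).
  rewrite /coord_field /cst !mxE /= ![_ == d]eq_sym.
  by congr frame_along; ring.
have S c d : second_fundamental_form g phi (coord_field c) (coord_field d) u =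
   let c0 := (c == 0)%:R in let d0 := (d == 0)%:R in
   let w := c0 * slope (u 0 0) + (c == 1)%:R in
   frame_along (u 0 0) 0
    (c0 * (k * d0 - a * (d0 * slope (u 0 0) + (d == 1)%:R)) - w * (a * d0)) 0.
  rewrite /second_fundamental_form N /=.
  rewrite (dmap_hopf m l (levi_civita _ _ _) J0) (levi_civita_induced j0 j1 db).
  rewrite !mxE /= frame_alongN frame_alongD -mulnb natrM.
  by congr frame_along; ring.
rewrite /tension (induced_metricE l j0 j1) trace_gram !S /= !frame_alongE.
by congr frame_along; ring.
Qed.

Section AlongArc.
Variables (J : set R) (k k1 : R -> R).
Hypothesis Jo : open J.
Hypothesis j0 : forall r, J r -> has_velocity r.
Hypothesis j1 : forall r, J r -> has_curvature r (k r) 0.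
Hypothesis dk : forall r, J r -> is_derive r 1 k (k1 r).

(** Sections whose frame components depend on s alone. Covariant derivatives along coordinate fields
    preserve this form, which reduces the rough Laplacian to ordinary derivatives. *)
Definition section_along V (f gg h : R -> R) := forall u, J (u 0 0) ->
  V u = frame_along (u 0 0) (f (u 0 0)) (gg (u 0 0)) (h (u 0 0)).

Definition deriv_on (f f1 : R -> R) := forall r, J r -> is_derive r 1 f (f1 r).

Lemma near_J r : J r -> \forall t \near r, J t.
Proof. by move=> Jr; exact: open_nbhs_nbhs. Qed.

Lemma nabla_section_along X V (f gg h : R -> R) (f1 g1 h1 : R) u :
  let s := u 0 0 in
  section_along V f gg h -> J s ->
  is_derive s 1 f f1 -> is_derive s 1 gg g1 -> is_derive s 1 h h1 ->
  let w := X u 0 0 * slope s + X u 0 1 in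
  nabla g phi X V u = frame_along s
     (X u 0 0 * (f1 - k s * gg s) + w * (a * gg s))
     (X u 0 0 * (g1 + k s * f s - a * h s) - w * (a * f s))
     (X u 0 0 * (h1 + a * gg s)).
Proof.
move=> s VE Ju df dg dh w.
rewrite (nabla_frame _ (j0 Ju) (j1 Ju) df dg dh).
  by congr frame_along; rewrite ?mul0r ?addr0.
by apply: filterS (near_first (near_J Ju)) => t /VE.
Qed.

(** As e = 0 on J, T and xi are parallel for the induced metric, and the operator is - (nabla_T
    nabla_T + nabla_xi nabla_xi). *)
Lemma rough_laplacian_section_along V f f1 f2 gg g1 g2 h h1 h2 :
  section_along V f gg h -> deriv_on f f1 -> deriv_on f1 f2 -> deriv_on gg g1 -> deriv_on g1 g2 ->
  deriv_on h h1 -> deriv_on h1 h2 ->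
  section_along (rough_laplacian g phi V)
   (fun s => - (f2 s - k1 s * gg s - 2 * k s * g1 s - k s ^+ 2 * f s
        + a * k s * h s - a ^+ 2 * f s))
   (fun s => - (g2 s + k1 s * f s + 2 * k s * f1 s - 2 * a * h1 s
        - k s ^+ 2 * gg s - 2 * a ^+ 2 * gg s))
   (fun s => - (h2 s + 2 * a * g1 s + a * k s * f s - a ^+ 2 * h s)).
Proof.
move=> VE df df1 dg dg1 dh dh1 u Ju.
have nJ : \forall r \near u 0 0, has_velocity r by apply: filterS (near_J Ju) => r /j0.
have [b1 db] := is_derive_slope l (j0 Ju) (j1 Ju).
have LC := levi_civita_induced nJ (j1 Ju) db.
rewrite /rough_laplacian (induced_metricE l nJ (j1 Ju)) trace_gram.
have N c : section_along (nabla g phi (coord_field c) V)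
   (fun s => (c == 0)%:R * (f1 s - k s * gg s)
      + ((c == 0)%:R * slope s + (c == 1)%:R) * (a * gg s))
   (fun s => (c == 0)%:R * (g1 s + k s * f s - a * h s)
      - ((c == 0)%:R * slope s + (c == 1)%:R) * (a * f s))
   (fun s => (c == 0)%:R * (h1 s + a * gg s)).
  move=> w Jw; rewrite (nabla_section_along _ VE Jw (df _ Jw) (dg _ Jw) (dh _ Jw)).
  by rewrite /coord_field /cst !mxE /= ![_ == c]eq_sym.
have S c d : section_hessian g phi V (coord_field c) (coord_field d) u =
   let s := u 0 0 in
   let c0 := (c == 0)%:R in let d0 := (d == 0)%:R in
   let w := c0 * slope s + (c == 1)%:R in
   let z := d0 * slope s + (d == 1)%:R in
   let A := d0 * (f1 s - k s * gg s) + z * (a * gg s) in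
   let B := d0 * (g1 s + k s * f s - a * h s) - z * (a * f s) in
   let C := d0 * (h1 s + a * gg s) in
   frame_along s
    (c0 * (d0 * (f2 s - k1 s * gg s - k s * g1 s) + z * (a * g1 s) - k s * B)
     + w * (a * B))
    (c0 * (d0 * (g2 s + k1 s * f s + k s * f1 s - a * h1 s) - z * (a * f1 s)
           + k s * A - a * C) - w * (a * A))
    (c0 * (d0 * (h2 s + a * g1 s) + a * B)).
  rewrite /section_hessian /=.
  move: (df _ Ju) (df1 _ Ju) (dg _ Ju) (dg1 _ Ju) (dh _ Ju) (dh1 _ Ju) (dk Ju).
  move=> /= Df Df1 Dg Dg1 Dh Dh1 Dk.
  rewrite (nabla_section_along _ VE Ju Df Dg Dh) LC.
  have D1 : is_derive (u 0 0) 1 (fun s => (d == 0)%:R * (f1 s - k s * gg s) +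
      ((d == 0)%:R * slope s + (d == 1)%:R) * (a * gg s))
      ((d == 0)%:R * (f2 (u 0 0) - k1 (u 0 0) * gg (u 0 0) - k (u 0 0) * g1 (u 0 0))
       + ((d == 0)%:R * slope (u 0 0) + (d == 1)%:R) * (a * g1 (u 0 0))
       + (d == 0)%:R * b1 * (a * gg (u 0 0))).
    by notypeclasses refine (is_derive_val _ _); [derive_rules|rewrite /=; ring].
  have D2 : is_derive (u 0 0) 1 (fun s => (d == 0)%:R * (g1 s + k s * f s - a * h s) -
      ((d == 0)%:R * slope s + (d == 1)%:R) * (a * f s))
      ((d == 0)%:R * (g2 (u 0 0) + k1 (u 0 0) * f (u 0 0) + k (u 0 0) * f1 (u 0 0)
          - a * h1 (u 0 0))
       - ((d == 0)%:R * slope (u 0 0) + (d == 1)%:R) * (a * f1 (u 0 0))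
       - (d == 0)%:R * b1 * (a * f (u 0 0))).
    by notypeclasses refine (is_derive_val _ _); [derive_rules|rewrite /=; ring].
  have D3 : is_derive (u 0 0) 1 (fun s => (d == 0)%:R * (h1 s + a * gg s))
      ((d == 0)%:R * (h2 (u 0 0) + a * g1 (u 0 0))).
    by notypeclasses refine (is_derive_val _ _); [derive_rules|rewrite /=; ring].
  rewrite (nabla_section_along _ (N d) Ju D1 D2 D3) /=.
  rewrite !mxE /= ![_ == c]eq_sym frame_alongN frame_alongD -mulnb natrM.
  by congr frame_along; ring.
rewrite !S /= !frame_alongE.
by congr frame_along; ring.
Qed.
End AlongArc.
End Tension.

Lemma congr3 (A B C D : Type) (f : A -> B -> C -> D) a a' b b' c c' :
  a = a' -> b = b' -> c = c' -> f a b c = f a' b' c'.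
Proof. by move=> -> -> ->. Qed.

Lemma eq_trace {R : realType} d n (G : 'M[R]_d) (B B' : 'I_d -> 'I_d -> 'rV[R]_n) :
  (forall c c', B c c' = B' c c') -> trace G B = trace G B'.
Proof.
by move=> E; rewrite /trace; apply: eq_bigr => c _; apply: eq_bigr => c' _; rewrite E.
Qed.

(** * The 3-tension field in the frame *)

Section ThreeTension.
Context {R : realType}.
Variables m l : R.
Local Notation F := (bcv_factor m).
Local Notation g := (bcv_metric m l).
Local Notation a := (l / 2).
Variables (gamma : R -> 'rV[R]_2) (x1 y1 : R -> R).
Local Notation phi := (hopf_cylinder gamma).
Local Notation x := (fun s => gamma s 0 0).
Local Notation y := (fun s => gamma s 0 1).
Local Notation frame_along := (frame_along m l gamma x1 y1).
Local Notation has_velocity := (has_velocity gamma x1 y1).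
Local Notation has_curvature := (has_curvature m gamma x1 y1).
Local Notation slope := (slope m l gamma x1 y1).
Implicit Types (u v : 'rV[R]_2) (X : 'rV[R]_2 -> 'rV[R]_2) (V : 'rV[R]_2 -> 'rV[R]_3).

Variables (J : set R) (k k1 k2 k3 k4 : R -> R).
Hypothesis Jo : open J.
Hypothesis j0 : forall r, J r -> has_velocity r.
Hypothesis j1 : forall r, J r -> has_curvature r (k r) 0.
Local Notation deriv_on := (deriv_on J).
Hypothesis dk : deriv_on k k1.
Hypothesis dk1 : deriv_on k1 k2.
Hypothesis dk2 : deriv_on k2 k3.
Hypothesis dk3 : deriv_on k3 k4.
Local Notation section_along := (section_along m l gamma x1 y1 J).

Lemma tension_along : section_along (tension g phi) (fun=> 0) k (fun=> 0).
Proof.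
move=> u Ju; apply: tension_hopf (j1 Ju).
by apply: filterS (near_J Jo Ju) => r /j0.
Qed.

Lemma laplacian_tension_along : section_along (rough_laplacian g phi (tension g phi))
  (fun s => 3 * k s * k1 s) (fun s => k s ^+ 3 + 2 * a ^+ 2 * k s - k2 s)
  (fun s => - (2 * a * k1 s)).
Proof.
move=> u Ju; have d0 : deriv_on (fun=> 0) (fun=> 0).
  by move=> r _; exact: is_derive_const.
rewrite (rough_laplacian_section_along Jo j0 j1 dk tension_along d0 d0 dk dk1 d0 d0 Ju).
by congr frame_along; ring.
Qed.

(** The leading term is the rough Laplacian of [laplacian_tension_along]. The curvature terms follow
    from nabla_T tau = - k^2 T + k' N + a k xi, nabla_xi tau = a k T and [curv_frame]. *)
Lemma tension3_hopf u : J (u 0 0) ->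
  let s := u 0 0 in
  let gg := k s ^+ 3 + 2 * a ^+ 2 * k s - k2 s in
  tension3 g phi u = frame_along s
   (- (5 * k s * k3 s + 10 * k1 s * k2 s - 10 * k s ^+ 3 * k1 s
       - 8 * a ^+ 2 * k s * k1 s))
   (- ((6 * k s * k1 s ^+ 2 + 3 * k s ^+ 2 * k2 s + 2 * a ^+ 2 * k2 s - k4 s)
       + 3 * k s * k1 s ^+ 2 + 6 * k s * (k1 s ^+ 2 + k s * k2 s)
       + 4 * a ^+ 2 * k2 s - (k s ^+ 2 + 2 * a ^+ 2) * gg)
    - (4 * m - 2 * a ^+ 2) * gg - (4 * m - 3 * a ^+ 2) * k s ^+ 3)
   (- a * (9 * k s ^+ 2 * k1 s + 4 * a ^+ 2 * k1 s - 4 * k3 s)).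
Proof.
move=> Ju s gg.
have nJ : \forall r \near u 0 0, has_velocity r by apply: filterS (near_J Jo Ju) => r /j0.
have J1 := j1 Ju; have [F0 un _ _] := J1.
have px := hopf_cylinder0 gamma u; have py := hopf_cylinder1 gamma u.
have Fp : F (phi u) != 0 by rewrite /bcv_factor px py.
have Df : deriv_on (fun s => 3 * k s * k1 s) (fun s => 3 * (k1 s ^+ 2 + k s * k2 s)).
  move=> r Jr; have D := dk Jr; have D1 := dk1 Jr.
  by notypeclasses refine (is_derive_val _ _); [derive_rules|rewrite /=; ring].
have Df1 : deriv_on (fun s => 3 * (k1 s ^+ 2 + k s * k2 s))
    (fun s => 3 * (3 * k1 s * k2 s + k s * k3 s)).
  move=> r Jr; have D := dk Jr; have D1 := dk1 Jr; have D2 := dk2 Jr.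
  by notypeclasses refine (is_derive_val _ _); [derive_rules|rewrite /=; ring].
have Dg : deriv_on (fun s => k s ^+ 3 + 2 * a ^+ 2 * k s - k2 s)
    (fun s => 3 * k s ^+ 2 * k1 s + 2 * a ^+ 2 * k1 s - k3 s).
  move=> r Jr; have D := dk Jr; have D2 := dk2 Jr.
  by notypeclasses refine (is_derive_val _ _); [derive_rules|rewrite /=; ring].
have Dg1 : deriv_on (fun s => 3 * k s ^+ 2 * k1 s + 2 * a ^+ 2 * k1 s - k3 s)
    (fun s => 6 * k s * k1 s ^+ 2 + 3 * k s ^+ 2 * k2 s + 2 * a ^+ 2 * k2 s - k4 s).
  move=> r Jr; have D := dk Jr; have D1 := dk1 Jr; have D3 := dk3 Jr.
  by notypeclasses refine (is_derive_val _ _); [derive_rules|rewrite /=; ring].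
have Dh : deriv_on (fun s => - (2 * a * k1 s)) (fun s => - (2 * a * k2 s)).
  move=> r Jr; have D1 := dk1 Jr.
  by notypeclasses refine (is_derive_val _ _); [derive_rules|rewrite /=; ring].
have Dh1 : deriv_on (fun s => - (2 * a * k2 s)) (fun s => - (2 * a * k3 s)).
  move=> r Jr; have D2 := dk2 Jr.
  by notypeclasses refine (is_derive_val _ _); [derive_rules|rewrite /=; ring].
have L2 := rough_laplacian_section_along Jo j0 j1 dk laplacian_tension_along
  Df Df1 Dg Dg1 Dh Dh1.
have dphi (c : 'I_2) : dmap phi (coord_field c) u =
    frame_along s (c == 0)%:R 0 ((c == 0)%:R * slope s + (c == 1)%:R).
  rewrite (dmap_hopf m l _ (j0 Ju)) /coord_field /cst !mxE /=.
  by rewrite ![_ == c]eq_sym.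
have z0 := is_derive_const 0 (u 0 0) 1.
have dtau (c : 'I_2) : nabla g phi (coord_field c) (tension g phi) u =
    frame_along s (- (c == 0)%:R * k s ^+ 2
              + ((c == 0)%:R * slope s + (c == 1)%:R) * (a * k s))
       ((c == 0)%:R * k1 s) ((c == 0)%:R * (a * k s)).
  rewrite (nabla_section_along Jo j0 j1 _ tension_along Ju z0 (dk Ju) z0).
  rewrite /coord_field /cst !mxE /= ![_ == c]eq_sym.
  by congr frame_along; rewrite /s; ring.
have curvE f1 g1 h1 f2 g2 h2 f3 g3 h3 :
  riemann g (phi u) (frame_along s f1 g1 h1) (frame_along s f2 g2 h2) (frame_along s f3 g3 h3) =
  _ := etrans (riemann_bcv l _ _ _ Fp)
    (curv_frame l px py F0 un f1 g1 h1 f2 g2 h2 f3 g3 h3).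
(* Rewriting in tension3 would have Rocq compare the two traces by conversion,
   which does not terminate; hence E1, E2 and congr3. *)
have E1 : trace (induced_metric g phi u) (fun c d =>
   riemann g (phi u) (rough_laplacian g phi (tension g phi) u)
     (dmap phi (coord_field c) u) (dmap phi (coord_field d) u)) =
   frame_along s (a ^+ 2 * (3 * k s * k1 s)) ((4 * m - 2 * a ^+ 2) * gg)
      (- (a ^+ 2 * (2 * a * k1 s))).
  rewrite (eq_trace _ (fun c d => congr3 (riemann g (phi u))
    (laplacian_tension_along Ju) (dphi c) (dphi d))).
  rewrite (eq_trace _ (fun c d => curvE _ _ _ _ _ _ _ _ _)).
  rewrite (induced_metricE l nJ J1) trace_gram /= -!/(frame_along s _ _ _) !frame_alongE.
  by congr frame_along; rewrite /gg /s; field.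
have E2 : trace (induced_metric g phi u) (fun c d =>
   riemann g (phi u) (nabla g phi (coord_field c) (tension g phi) u)
     (tension g phi u) (dmap phi (coord_field d) u)) =
   frame_along s 0 ((4 * m - 3 * a ^+ 2) * k s ^+ 3) 0.
  rewrite (eq_trace _ (fun c d => congr3 (riemann g (phi u))
    (dtau c) (tension_along Ju) (dphi d))).
  rewrite (eq_trace _ (fun c d => curvE _ _ _ _ _ _ _ _ _)).
  rewrite (induced_metricE l nJ J1) trace_gram /= -!/(frame_along s _ _ _) !frame_alongE.
  by congr frame_along; rewrite /s; field.
rewrite /tension3.
apply: etrans; first exact: (congr3 (fun p q r => p - q - r) (L2 _ Ju) E1 E2).
rewrite !frame_alongE.
by congr frame_along; rewrite /gg /s; field.
Qed.
End ThreeTension.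

(** * The differential equations for the curvature *)

Section TriharmonicEquations.
Context {R : realType}.

(** Mean value theorem. The equations for k are available in the interior, so only there is the
    derivative asked to vanish; differentiability at the ends gives continuity. *)
Lemma derivative0_eq (f : R -> R) (p q : R) :
  p <= q -> (forall r, r \in `[p, q] -> derivable f r 1) ->
  (forall r, r \in `]p, q[ -> is_derive r 1 f 0) -> f p = f q.
Proof.
move=> pq df f0; apply/eqP; rewrite eq_sym -subr_eq0.
have [c _ ->] := MVT_segment pq f0 (derivable_within_continuous df).
by rewrite mul0r.
Qed.

Lemma derivative0_cst (f : R -> R) (p q : R) :
  (forall r, r \in `]p, q[ -> is_derive r 1 f 0) ->
  forall r t, r \in `]p, q[ -> t \in `]p, q[ -> f r = f t.
Proof.
move=> f0; suff H r t : r \in `]p, q[ -> t \in `]p, q[ -> r <= t -> f r = f t.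
  move=> r t rJ tJ; have [/H ->//|/ltW/H] := leP r t; by move=> ->.
rewrite !in_itv /= => /andP[pr rq] /andP[pt tq] rt.
notypeclasses refine (@derivative0_eq f r t rt _ _) => z.
  rewrite in_itv /= => /andP[rz zt].
  have [] // := f0 z; by rewrite in_itv /= (lt_le_trans pr rz) (le_lt_trans zt tq).
rewrite in_itv /= => /andP[rz zt].
by apply: f0; rewrite in_itv /= (lt_trans pr rz) (lt_trans zt tq).
Qed.

(** Differentiating P(k) = 0 gives P'(k) k' = 0, so P'(k) = 0 and P' = 0 by induction on the size; P
    is then a constant with value 0. *)
Lemma poly_near_eq0 (k k1 : R -> R) (s : R) (P : {poly R}) :
  (\forall r \near s, is_derive (r : R) 1 k (k1 r)) ->
  (\forall r \near s, k1 r != 0) ->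
  (\forall r \near s, P.[k r] = 0) -> P = 0.
Proof.
move=> dk k10; have [n] := ubnP (size P); elim: n P => // n IH P szP P0.
have [//|Pn0] := eqVneq P 0.
have dP : P^`()%R = 0.
  apply: IH; first exact: leq_trans (lt_size_deriv Pn0) _.
  apply: filterS3 dk k10 (near_join P0) => r dr r0 Pr.
  have [_ E] := is_derive1_comp (is_derive_poly P (k r)) dr.
  have E0 : 'D_1 (horner P \o k) r = 0.
    by rewrite (@near_eq_derive _ _ _ _ (cst 0) r 1 Pr) derive_cst.
  by move: E; rewrite E0 => /esym/eqP; rewrite mulf_eq0 (negbTE r0) orbF => /eqP.
(* In characteristic 0 the top coefficient of P' is the degree times the leading coefficient of
   P. *)
have szP1 : (size P <= 1)%N.
  rewrite leqNgt; apply/negP => sz.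
  have := congr1 (fun q : {poly R} => q`_(size P).-2) dP.
  rewrite coef_deriv coef0 => /eqP; rewrite mulrn_eq0.
  have E : (size P).-2.+1 = (size P).-1 by case: (size P) sz => [|[|]].
  rewrite E -/(lead_coef P) lead_coef_eq0 (negbTE Pn0) orbF => /eqP E1.
  by case: (size P) sz E1 => [|[|]].
move: (nbhs_singleton P0); rewrite (size1_polyC szP1) hornerC => ->.
by rewrite polyC0.
Qed.

Lemma triharmonic_ode_const (a m p q : R) (k k1 k2 k3 k4 : R -> R) :
  (forall r, r \in `]p, q[ -> is_derive r 1 k (k1 r)) ->
  (forall r, r \in `]p, q[ -> is_derive r 1 k1 (k2 r)) ->
  (forall r, r \in `]p, q[ -> is_derive r 1 k2 (k3 r)) ->
  (forall r, r \in `]p, q[ -> is_derive r 1 k3 (k4 r)) ->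
  (forall s, s \in `]p, q[ ->
    5 * k s * k3 s + 10 * k1 s * k2 s - 10 * k s ^+ 3 * k1 s
       - 8 * a ^+ 2 * k s * k1 s = 0) ->
  (a = 0 -> forall s, s \in `]p, q[ ->
    10 * k s ^+ 2 * k2 s + 15 * k s * k1 s ^+ 2 - k4 s - k s ^+ 5
      + 4 * m * (2 * k s ^+ 3 - k2 s) = 0) ->
  (forall s, s \in `]p, q[ ->
    a * (9 * k s ^+ 2 * k1 s + 4 * a ^+ 2 * k1 s - 4 * k3 s) = 0) ->
  forall s, s \in `]p, q[ -> k1 s = 0.
Proof.
move=> dk dk1 dk2 dk3 eT eN eX s sJ.
apply/eqP/negP => /negP k10.
have nJ r : r \in `]p, q[ -> \forall t \near r, t \in `]p, q[.
  by move=> rJ; exact: near_in_itvoo.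
have nk1 : \forall r \near s, k1 r != 0.
  have [/derivable1_diffP/differentiable_continuous/cvgr_neq0 d _] := dk1 s sJ.
  exact: d.
have [a0|a0] := eqVneq a 0; last first.
  have E : \forall r \near s, 10 * k2 r - 3 * a ^+ 2 * k r + 5 / 4 * k r ^+ 3 = 0.
    apply: filterS2 nk1 (nJ s sJ) => r r0 rJ.
    have X : 9 * k r ^+ 2 * k1 r + 4 * a ^+ 2 * k1 r - 4 * k3 r = 0.
      by apply/eqP; move/eqP: (eX r rJ); rewrite mulf_eq0 (negbTE a0).
    have T := eT r rJ.
    apply: (mulfI r0); rewrite mulr0.
    (* Adding 5/4 k times the xi-equation cancels k''', and the remainder has the factor k'. *)
    transitivity ((5 * k r * k3 r + 10 * k1 r * k2 r - 10 * k r ^+ 3 * k1 r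
       - 8 * a ^+ 2 * k r * k1 r) + 5 / 4 * k r *
       (9 * k r ^+ 2 * k1 r + 4 * a ^+ 2 * k1 r - 4 * k3 r)).
      by field.
    by rewrite X T; ring.
  have D := dk s sJ; have D2 := dk2 s sJ.
  have [_ DE] : is_derive s 1 (fun r => 10 * k2 r - 3 * a ^+ 2 * k r + 5 / 4 * k r ^+ 3)
    (10 * k3 s - 3 * a ^+ 2 * k1 s + 15 / 4 * k s ^+ 2 * k1 s).
    by notypeclasses refine (is_derive_val _ _); [derive_rules|rewrite /=; field].
  have X : 9 * k s ^+ 2 * k1 s + 4 * a ^+ 2 * k1 s - 4 * k3 s = 0.
    by apply/eqP; move/eqP: (eX s sJ); rewrite mulf_eq0 (negbTE a0).
  move: DE; rewrite (@near_eq_derive _ _ _ _ (cst 0) s 1 E) derive_cst => DE.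
  have : k1 s * (105 * k s ^+ 2 + 28 * a ^+ 2) = 0.
    (* The weights 4 and 10 cancel k'''. *)
    transitivity (4 * (10 * k3 s - 3 * a ^+ 2 * k1 s + 15 / 4 * k s ^+ 2 * k1 s)
      + 10 * (9 * k s ^+ 2 * k1 s + 4 * a ^+ 2 * k1 s - 4 * k3 s)).
      by field.
    by rewrite -DE X; ring.
  move/eqP; rewrite mulf_eq0 (negbTE k10) /= => /eqP Z.
  have a2 : 0 < a ^+ 2 by rewrite exprn_even_gt0.
  have := sqr_ge0 (k s); lra.
have T r : r \in `]p, q[ -> k r * k3 r + 2 * k1 r * k2 r - 2 * k r ^+ 3 * k1 r = 0.
  move=> rJ; have := eT r rJ; rewrite a0 => h.
  apply: (mulfI (x := 5)); first by rewrite pnatr_eq0.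
  by rewrite mulr0 -h; ring.
have T1 r : r \in `]p, q[ -> k r * k4 r + 3 * k1 r * k3 r + 2 * k2 r ^+ 2
    - 6 * k r ^+ 2 * k1 r ^+ 2 - 2 * k r ^+ 3 * k2 r = 0.
  move=> rJ; have D := dk r rJ; have D1 := dk1 r rJ; have D2 := dk2 r rJ.
  have D3 := dk3 r rJ.
  have [_ DE] : is_derive r 1 (fun r => k r * k3 r + 2 * k1 r * k2 r - 2 * k r ^+ 3 * k1 r)
    (k r * k4 r + 3 * k1 r * k3 r + 2 * k2 r ^+ 2
    - 6 * k r ^+ 2 * k1 r ^+ 2 - 2 * k r ^+ 3 * k2 r).
    by notypeclasses refine (is_derive_val _ _); [derive_rules|rewrite /=; ring].
  rewrite -DE (@near_eq_derive _ _ _ _ (cst 0)) ?derive_cst //.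
  by apply: filterS (nJ r rJ) => t /T.
(* The derivative of this expression is twice the left-hand side of [T]. *)
pose C := 2 * k s * k2 s + k1 s ^+ 2 - k s ^+ 4.
have CE r : r \in `]p, q[ -> 2 * k r * k2 r + k1 r ^+ 2 - k r ^+ 4 = C.
  move=> rJ.
  refine (derivative0_cst (f := fun r => 2 * k r * k2 r + k1 r ^+ 2 - k r ^+ 4) _ rJ sJ).
  move=> t tJ; have D := dk t tJ; have D1 := dk1 t tJ; have D2 := dk2 t tJ.
  notypeclasses refine (is_derive_val _ _); [derive_rules|].
  transitivity (2 * (k t * k3 t + 2 * k1 t * k2 t - 2 * k t ^+ 3 * k1 t)).
    by rewrite /=; ring.
  by rewrite T // mulr0.
(* With C constant, the derivative is k' (2 k k'' + k'^2 - k^4 - C), which vanishes by [CE]. *)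
pose D := k s * k1 s ^+ 2 - k s ^+ 5 / 5 - C * k s.
have DE r : r \in `]p, q[ -> k r * k1 r ^+ 2 - k r ^+ 5 / 5 - C * k r = D.
  move=> rJ.
  refine (derivative0_cst (f := fun r => k r * k1 r ^+ 2 - k r ^+ 5 / 5 - C * k r) _ rJ sJ).
  move=> t tJ; have D0 := dk t tJ; have D1 := dk1 t tJ.
  notypeclasses refine (is_derive_val _ _); [derive_rules|].
  by rewrite /= -(CE t tJ); field.
(* P evaluated at k is k^5 times the normal equation, once k k'^2 and k^2 k''
   are expressed by k, C and D. *)
pose P := Poly [:: 7 / 2 * D ^+ 2; 3 * C * D; 0; 2 * m * D; 0; 42 / 5 * D;
  63 / 5 * C; 0; 32 / 5 * m; 0; 126 / 25].
have P0 : P = 0.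
  apply: (@poly_near_eq0 k k1 s); [by apply: filterS (nJ s sJ) | by [] |].
  apply: filterS (nJ s sJ) => r rJ.
  have X := DE r rJ; have N := eN a0 r rJ; have Tr := T r rJ; have T1r := T1 r rJ.
  have Cr := CE r rJ.
  have {}X : k r * k1 r ^+ 2 = k r ^+ 5 / 5 + C * k r + D by rewrite -X; ring.
  have Y : k r ^+ 2 * k2 r = 2 / 5 * k r ^+ 5 - D / 2.
    transitivity (k r / 2 * (2 * k r * k2 r + k1 r ^+ 2 - k r ^+ 4)
       - (k r * k1 r ^+ 2) / 2 + k r ^+ 5 / 2); first by field.
    by rewrite Cr X; field.
  (* k^4 times [T1] minus 3 k^3 k' times [T] is free of k'''. *)
  have Z : k r ^+ 5 * k4 r = 6 * (k r * k1 r ^+ 2) * (k r ^+ 2 * k2 r)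
      - 2 * (k r ^+ 2 * k2 r) ^+ 2 + 2 * k r ^+ 5 * (k r ^+ 2 * k2 r).
    apply/eqP; rewrite -subr_eq0; apply/eqP.
    transitivity (k r ^+ 4 * (k r * k4 r + 3 * k1 r * k3 r + 2 * k2 r ^+ 2
        - 6 * k r ^+ 2 * k1 r ^+ 2 - 2 * k r ^+ 3 * k2 r)
      - 3 * k r ^+ 3 * k1 r * (k r * k3 r + 2 * k1 r * k2 r - 2 * k r ^+ 3 * k1 r)).
      by ring.
    by rewrite Tr T1r; ring.
  transitivity (k r ^+ 5 * (10 * k r ^+ 2 * k2 r + 15 * k r * k1 r ^+ 2 - k4 r
     - k r ^+ 5 + 4 * m * (2 * k r ^+ 3 - k2 r))); last by rewrite N mulr0.
  transitivity (10 * k r ^+ 5 * (k r ^+ 2 * k2 r) + 15 * k r ^+ 5 * (k r * k1 r ^+ 2)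
     - k r ^+ 5 * k4 r - k r ^+ 10
     + 4 * m * (2 * k r ^+ 8 - k r ^+ 3 * (k r ^+ 2 * k2 r))); last by ring.
  by rewrite Z X Y /P horner_Poly /=; field.
have := congr1 (fun q : {poly R} => q`_10) P0.
rewrite /P coef_Poly coef0 /= => /eqP.
by rewrite mulf_eq0 invr_eq0 !pnatr_eq0.
Qed.
End TriharmonicEquations.

(** * Functions differentiable n times at the points of a set *)

Section DifferentiabilityClass.
Context {R : realType}.
Variable J : R -> Prop.

(** Derivatives are explicit witnesses, total functions with values prescribed on J; order 4 of the
    curvature yields the functions k1, ..., k4 of the differential equations. *)
Fixpoint diff_n (n : nat) (f : R -> R) : Prop :=
  if n is n'.+1 then
    exists f', (forall r, J r -> is_derive r 1 f (f' r)) /\ diff_n n' f'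
  else True.

Lemma diff_nS n f : diff_n n.+1 f -> diff_n n f.
Proof.
elim: n f => // n IH f [f' [df /IH h]]; by exists f'.
Qed.

Lemma diff_n_const n c : diff_n n (fun=> c).
Proof.
elim: n c => // n IH c; exists (fun=> 0); split=> // r _.
exact: is_derive_const.
Qed.

Lemma diff_n_add n f g : diff_n n f -> diff_n n g -> diff_n n (fun r => f r + g r).
Proof.
elim: n f g => // n IH f g [f' [df f'n]] [g' [dg g'n]].
exists (fun r => f' r + g' r); split; last exact: IH.
by move=> r Jr; apply: is_derive_add; [exact: df|exact: dg].
Qed.

Lemma diff_n_opp n f : diff_n n f -> diff_n n (fun r => - f r).
Proof.
elim: n f => // n IH f [f' [df f'n]].
exists (fun r => - f' r); split; last exact: IH.
by move=> r Jr; apply: is_derive_opp; exact: df.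
Qed.

Lemma diff_n_mul n f g : diff_n n f -> diff_n n g -> diff_n n (fun r => f r * g r).
Proof.
elim: n f g => // n IH f g fn gn.
have fn1 := diff_nS fn; have gn1 := diff_nS gn.
case: fn gn => f' [df f'n] [g' [dg g'n]].
exists (fun r => f r * g' r + g r * f' r); split.
  by move=> r Jr; apply: is_derive_mul; [exact: df|exact: dg].
by apply: diff_n_add; apply: IH.
Qed.

Lemma diff_n_inv n f : (forall r, J r -> f r != 0) -> diff_n n f ->
  diff_n n (fun r => (f r)^-1).
Proof.
move=> f0; elim: n => // n IH fn.
have Vn := IH (diff_nS fn).
case: fn => f' [df f'n].
(* The square of 1/f is split into two factors, to which the induction hypothesis applies. *)
exists (fun r => - ((f r)^-1 * (f r)^-1) * f' r); split.
  move=> r Jr.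
  notypeclasses refine (is_derive_val (is_derive_inv (f0 r Jr) (df r Jr)) _).
  by rewrite expr2 invfM.
by apply: diff_n_mul => //; apply: diff_n_opp; exact: diff_n_mul.
Qed.

Lemma diff_n_exp n f i : diff_n n f -> diff_n n (fun r => f r ^+ i).
Proof.
move=> fn; elim: i => [|i IH].
  by under eq_fun do rewrite expr0; exact: diff_n_const.
by under eq_fun do rewrite exprS; exact: diff_n_mul.
Qed.

End DifferentiabilityClass.

(** * The geodesic curvature of the base curve and its constancy *)

Section HopfCylinderCurvature.
Context {R : realType}.
Variables (m l : R) (I : interval R) (gamma : R -> 'rV[R]_2).
Hypothesis gamma_smooth : forall s, s \in I -> smooth_at gamma s.
Hypothesis gamma_base : forall s, s \in I -> bcv_base m (gamma s).
Hypothesis gamma_arclength : forall s, s \in I ->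
      inner (base_metric m (gamma s)) (derive1 gamma s) (derive1 gamma s) = 1.

Definition curve_jet (i : 'I_2) (n : nat) (s : R) : R := derive1n n gamma s 0 i.
Local Notation X := (curve_jet 0).
Local Notation Y := (curve_jet 1).
Local Notation F s := (1 + m * (X 0 s ^+ 2 + Y 0 s ^+ 2)).

Lemma is_derive_curve_jet i n s :
  derivable (derive1n n gamma) s 1 ->
  is_derive s 1 (curve_jet i n) (curve_jet i n.+1 s).
Proof.
move=> d; rewrite /curve_jet /derive1n iterS -/(derive1n n gamma) derive1E.
by apply: is_derive_entry; split.
Qed.

Lemma has_velocity_near s : s \in I -> \forall r \near s, has_velocity gamma (X 1) (Y 1) r.
Proof.
move=> /gamma_smooth /(_ 0); apply: filterS => r d.
by split; [exact: (is_derive_curve_jet 0 d)|exact: (is_derive_curve_jet 1 d)].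
Qed.

Lemma curve_factor s : s \in I -> F s != 0.
Proof. by move=> /gamma_base h; rewrite gt_eqF. Qed.

Lemma curve_unit s : s \in I -> Y 1 s ^+ 2 = F s ^+ 2 - X 1 s ^+ 2.
Proof.
move=> sI; have F0 := curve_factor sI.
have := gamma_arclength sI; rewrite /inner /base_metric mul_mx_scalar -scalemxAl.
rewrite !mxE sum2 !mxE => h.
have F20 : F s ^+ 2 != 0 by rewrite expf_neq0.
have E : F s ^+ 2 = X 1 s ^+ 2 + Y 1 s ^+ 2.
  by apply: (mulfI (invr_neq0 F20)); rewrite mulVf // -h.
by rewrite E [X 1 s ^+ 2 + _]addrC addrK.
Qed.

(** The signed geodesic curvature of gamma in the conformal metric h: the Euclidean expression, with
    |gamma'| = F, plus the conformal correction. *)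
Definition curvature s :=
  (X 1 s * Y 2 s - Y 1 s * X 2 s) / F s ^+ 2
  + 2 * m * (Y 0 s * X 1 s - X 0 s * Y 1 s) / F s.

Definition speed_log_derivative s :=
  (X 1 s * X 2 s + Y 1 s * Y 2 s) / F s ^+ 2
  - 2 * m * (X 0 s * X 1 s + Y 0 s * Y 1 s) / F s.

(** By unit speed, (x1, y1) and (-y1, x1) are orthogonal of Euclidean length F; the covariant
    acceleration has coefficients e and k on them. *)
Lemma curve_has_curvature s : s \in I ->
  has_curvature m gamma (X 1) (Y 1) s (curvature s) (speed_log_derivative s).
Proof.
move=> sI; have F0 := curve_factor sI; have un := curve_unit sI.
have d1 : derivable (derive1n 1 gamma) s 1.
  exact: nbhs_singleton (gamma_smooth sI 1).
split => //.
- notypeclasses refine (is_derive_val (is_derive_curve_jet 0 d1) _).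
  rewrite /curvature /speed_log_derivative -/(X 0 s) -/(Y 0 s).
  move: (X 0 s) (Y 0 s) (X 1 s) (Y 1 s) (X 2 s) (Y 2 s) F0 un.
  move=> x y x1 y1 x2 y2 F0 un.
  by field: un.
- notypeclasses refine (is_derive_val (is_derive_curve_jet 1 d1) _).
  rewrite /curvature /speed_log_derivative -/(X 0 s) -/(Y 0 s).
  move: (X 0 s) (Y 0 s) (X 1 s) (Y 1 s) (X 2 s) (Y 2 s) F0 un.
  move=> x y x1 y1 x2 y2 F0 un.
  by field: un.
Qed.

Lemma diff_curvature n : diff_n (fun s => s \in I) n curvature.
Proof.
have dX i j k : diff_n (fun s => s \in I) k (curve_jet i j).
  elim: k j => // k IH j; exists (curve_jet i j.+1); split=> // r rI.
  apply: is_derive_curve_jet; exact: nbhs_singleton (gamma_smooth rI j).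
have dF k : diff_n (fun s => s \in I) k (fun s => F s).
  by do ?[apply: diff_n_add|apply: diff_n_mul|apply: diff_n_exp|exact: diff_n_const|exact: dX].
rewrite /curvature.
apply: diff_n_add; apply: diff_n_mul.
- by do ?[apply: diff_n_add|apply: diff_n_opp|apply: diff_n_mul|exact: dX].
- apply: diff_n_inv; last by apply: diff_n_exp.
  by move=> r rI; rewrite expf_neq0 // curve_factor.
- by do ?[exact: diff_n_const|apply: diff_n_add|apply: diff_n_opp|apply: diff_n_mul|exact: dX].
- by apply: diff_n_inv => // r; exact: curve_factor.
Qed.

Lemma mean_curvature_hopf (u : 'rV[R]_2) : u 0 0 \in I ->
  mean_curvature (bcv_metric m l) (hopf_cylinder gamma) u =
  Num.sqrt ((2^-1 * curvature (u 0 0)) ^+ 2).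
Proof.
move=> uI; have [F0 un _ _] := curve_has_curvature uI.
rewrite /mean_curvature /mean_curvature_vector.
rewrite (tension_hopf l (has_velocity_near uI) (curve_has_curvature uI)) frame_alongZ.
rewrite (inner_bcv m l (hopf_cylinder0 gamma u) (hopf_cylinder1 gamma u)).
rewrite (inner_frame l (hopf_cylinder0 gamma u) (hopf_cylinder1 gamma u) F0 un).
by congr Num.sqrt; ring.
Qed.

Hypothesis Sigma_triharmonic :
      triharmonic_on (bcv_metric m l) (hopf_cylinder gamma)
        (cylinder_domain I).

(** Each point of ]s, t[ has a neighborhood inside I, on which the speed is 1; hence e = 0 and the
    equations of [tension3_hopf] hold on an open arc. The endpoints are reached by the mean value
    theorem. *)
Lemma curvature_const s t : s \in I -> t \in I -> s <= t ->
  curvature s = curvature t.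
Proof.
move=> sI tI st.
have sub r : r \in `[s, t] -> r \in I.
  rewrite in_itv /= => /andP[sr rt].
  by apply: (interval_is_interval sI tI); rewrite sr rt.
have sub' r : r \in `]s, t[ -> r \in I.
  by move=> /subset_itv_oo_cc/sub.
have [k1 [dk [k2 [dk1 [k3 [dk2 [k4 [dk3 _]]]]]]]] := diff_curvature 4.
notypeclasses refine (@derivative0_eq _ curvature s t st _ _) => r rJ.
  by have [] := dk r (sub r rJ).
suff <- : k1 r = 0 by exact: dk (sub' r rJ).
have nJ r' : r' \in `]s, t[ -> \forall t' \near r', t' \in `]s, t[.
  by move=> rJ'; exact: near_in_itvoo.
(* The squared speed has derivative 2 e and is constant near r'. *)
have e0 r' : r' \in `]s, t[ -> speed_log_derivative r' = 0.
  move=> rJ'; have J0 := nbhs_singleton (has_velocity_near (sub' _ rJ')).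
  have [_ D] := is_derive_speed2 J0 (curve_has_curvature (sub' _ rJ')).
  have N : \forall t' \near r', speed2 m gamma (X 1) (Y 1) t' = cst 1 t'.
    by apply: filterS (nJ _ rJ') => t' /sub'/curve_has_curvature/speed2_unit.
  move: D; rewrite (near_eq_derive _ N) derive_cst => /esym/eqP.
  by rewrite mulf_eq0 pnatr_eq0 /= => /eqP.
pose J := [set` `]s, t[].
have Jo : open J by exact: interval_open.
have j0 r' : J r' -> has_velocity gamma (X 1) (Y 1) r'.
  by move=> /sub' h; exact: nbhs_singleton (has_velocity_near h).
have j1 r' : J r' -> has_curvature m gamma (X 1) (Y 1) r' (curvature r') 0.
  by move=> rJ'; rewrite -(e0 r' rJ'); exact: curve_has_curvature (sub' _ rJ').
pose a := l / 2.
have EQ r' : r' \in `]s, t[ -> let k := curvature in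
    let gg := k r' ^+ 3 + 2 * a ^+ 2 * k r' - k2 r' in
    [/\ 5 * k r' * k3 r' + 10 * k1 r' * k2 r' - 10 * k r' ^+ 3 * k1 r'
         - 8 * a ^+ 2 * k r' * k1 r' = 0,
     - ((6 * k r' * k1 r' ^+ 2 + 3 * k r' ^+ 2 * k2 r' + 2 * a ^+ 2 * k2 r' - k4 r')
       + 3 * k r' * k1 r' ^+ 2 + 6 * k r' * (k1 r' ^+ 2 + k r' * k2 r')
       + 4 * a ^+ 2 * k2 r' - (k r' ^+ 2 + 2 * a ^+ 2) * gg)
      - (4 * m - 2 * a ^+ 2) * gg - (4 * m - 3 * a ^+ 2) * k r' ^+ 3 = 0 &
      a * (9 * k r' ^+ 2 * k1 r' + 4 * a ^+ 2 * k1 r' - 4 * k3 r') = 0].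
  (* The components of tau_3 depend on s alone, so the point with t = 0 represents the fibre. *)
  move=> rJ' k gg; pose u : 'rV[R]_2 := row2 r' 0.
  have u0 : u 0 0 = r' by rewrite mxE.
  have uJ : J (u 0 0) by rewrite u0.
  have := tension3_hopf l Jo j0 j1 (fun z zJ => dk z (sub' z zJ))
    (fun z zJ => dk1 z (sub' z zJ)) (fun z zJ => dk2 z (sub' z zJ))
    (fun z zJ => dk3 z (sub' z zJ)) uJ.
  rewrite Sigma_triharmonic ?u0; last by rewrite /cylinder_domain /= u0; exact: sub'.
  have [F0 un _ _] := j1 r' rJ'.
  move=> /esym /(frame_eq0 F0 un) [/eqP T N X].
  split; first by apply/eqP; rewrite -oppr_eq0.
    exact: N.
  by apply/eqP; rewrite -oppr_eq0 -mulNr; apply/eqP.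
apply: (@triharmonic_ode_const _ a m s t curvature k1 k2 k3 k4) rJ
  => [z zJ|z zJ|z zJ|z zJ|z zJ|a0 z zJ|z zJ].
- exact: dk (sub' z zJ).
- exact: dk1 (sub' z zJ).
- exact: dk2 (sub' z zJ).
- exact: dk3 (sub' z zJ).
- by case: (EQ z zJ).
(* At a = 0 the N-component is minus the required expression. *)
- have [_ N _] := EQ z zJ; apply/eqP; rewrite -oppr_eq0; apply/eqP.
  by rewrite -N a0; ring.
- by case: (EQ z zJ).
Qed.
End HopfCylinderCurvature.

Theorem theorem2p1 (R : realType) (m l : R) (I : interval R)
    (gamma : R -> 'rV[R]_2)
    (gamma_smooth : forall s, s \in I -> smooth_at gamma s)
    (gamma_base : forall s, s \in I -> bcv_base m (gamma s))
    (gamma_arclength : forall s, s \in I ->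
      inner (base_metric m (gamma s)) (derive1 gamma s) (derive1 gamma s) = 1)
    (Sigma_triharmonic :
      triharmonic_on (bcv_metric m l) (hopf_cylinder gamma)
        (cylinder_domain I)) :
  cmc_on (bcv_metric m l) (hopf_cylinder gamma) (cylinder_domain I).
Proof.
have [[s0 s0I]|I0] := pselect (exists s0, s0 \in I); last first.
  (* Over an empty interval any constant serves. *)
  by exists 0 => u uI; exfalso; apply: I0; exists (u 0 0).
(* As tau = k N, the mean curvature is |k| / 2. *)
exists (Num.sqrt ((2^-1 * curvature m gamma s0) ^+ 2)) => u uI.
rewrite (mean_curvature_hopf l gamma_smooth gamma_base gamma_arclength uI).
congr (Num.sqrt ((_ * _) ^+ 2)).
have K := curvature_const gamma_smooth gamma_base gamma_arclength Sigma_triharmonic.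
by have [/(K _ _ uI s0I)|/ltW/(K _ _ s0I uI)] := leP (u 0 0) s0.
Qed.
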